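(* Let $n\ge 2$, let $K\subseteq\mathbb{S}^n$ be a centrally-symmetric spherically convex body with center $e\in\mathbb{S}^n$, and let $g_e:\mathrm{int}\,\mathbb{S}_e^+\to\mathbb{R}^n_e$ denote the gnomonic projection. Then the set $\Gamma_sK$ defined by \[\mathrm{bd}\,\Gamma_sK=\{c_s(K\cap\mathbb{S}_u^+):u\in\mathbb{S}_e\}\] is a centrally-symmetric spherically convex body which is proper and has center $e$. Moreover, \[ g_e(\Gamma_s K) = \Gamma_{\widehat{\tau}}\, g_e(K \cap \mathrm{int}\,\mathbb{S}_e^+).\]
   Context: $\mathbb{S}^n$ is the Euclidean unit sphere of $\mathbb{R}^{n+1}$, $n\ge 2$, and $\sigma$ is spherical Lebesgue measure on it. For $u\in\mathbb{S}^n$ let $\mathbb{S}_u^+=\{v\in\mathbb{S}^n: u\cdot v\ge 0\}$ and $\mathbb{S}_u=\mathbb{S}^n\cap u^\perp$. Interior and boundary of subsets of $\mathbb{S}^n$ are relative to $\mathbb{S}^n$. A set $A\subseteq\mathbb{S}^n$ is (spherically) convex if $\{\lambda u:\lambda\ge 0,u\in A\}$ is convex in $\mathbb{R}^{n+1}$. A (spherically) convex body is a closed convex set $K\subseteq \mathbb{S}^n$, $K\neq\mathbb{S}^n$, with nonempty interior; it is proper if it is contained in some open hemisphere. For $e,v\in\mathbb{S}^n$ put $v^e=-v+2(v\cdot e)e$. $K$ is centrally-symmetric with center $e$ if $K^e=\{v^e:v\in K\}=K$; the center is taken so that $K\subseteq\mathbb{S}_e^+$. The spherical centroid of a Borel set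 $A\subseteq\mathbb{S}^n$ with $\sigma(A)>0$ is $c_s(A)=\frac{\int_A u\,d\sigma(u)}{\|\int_A u\,d\sigma(u)\|}$ whenever the denominator is nonzero. Defining $\Gamma_sK$ by its boundary means that $\Gamma_sK$ is the spherically convex body having the given set as boundary; that such a body exists is part of the assertion. $\mathbb{R}^n_e=e^\perp\subset\mathbb{R}^{n+1}$ (identified with $\mathbb{R}^n$) and $g_e(v)=\frac{v}{e\cdot v}-e$. $\widehat{\tau}$ is the measure on $\mathbb{R}^n_e$ with density $\psi(x)=(1+\|x\|^2)^{-\frac{n+2}{2}}$ with respect to Lebesgue measure. For a closed convex (possibly unbounded) set $M\subseteq\mathbb{R}^n_e$ with nonempty interior, $\Gamma_{\widehat{\tau}}M$ is the convex body (compact convex set with nonempty interior) with support function $h(\Gamma_{\widehat{\tau}}M,u)=\frac{1}{\widehat{\tau}(M)}\int_M|u\cdot y|\,d\widehat{\tau}(y)$, where $h(L,u)=\max\{u\cdot x:x\in L\}$. *)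

(* Defs.v *)
From HB Require Import structures.
From mathcomp Require Import all_boot all_order all_algebra.
From mathcomp Require Import interval_inference ring.
From mathcomp Require Import all_classical all_reals all_analysis.
From mathcomp Require Import measurable_realfun.

Set Implicit Arguments.
Unset Strict Implicit.
Unset Printing Implicit Defensive.

Import Order.TTheory GRing.Theory Num.Theory.
Import numFieldNormedType.Exports.

Local Open Scope classical_set_scope.
Local Open Scope ring_scope.

(** R^n is ['rV[R]_n], whose library norm is the sup norm: the Euclidean norm
    [enorm] below is used throughout; both induce the same topology. *)

Section euclidean.
Context {R : realType} {n : nat}.
Implicit Types (u v x : 'rV[R]_n) (X A L : set 'rV[R]_n).

Definition dot u v : R := (u *m v^T) 0 0.
Definition enorm u : R := Num.sqrt (dot u u).
Definition normalize u : 'rV[R]_n := (enorm u)^-1 *: u.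

Definition convex_row A := convex_set (A : set (convex_lmodType 'rV[R]_n)).

Definition rel_interior X A : set 'rV[R]_n :=
  [set x | X x /\ within X (nbhs x) A].
Definition rel_boundary X A : set 'rV[R]_n :=
  (closure A `&` X) `\` rel_interior X A.

Definition orthogonal_compl v : set 'rV[R]_n := [set x | dot v x = 0].

Definition support_function L u : R := sup [set dot u x | x in L].

End euclidean.

(** The product sigma-algebra on R^n; it is the Borel sigma-algebra. *)

Fact row_display : measure_display -> measure_display.
Proof. by []. Qed.

Section measurable_row.
Context {R : realType} {n : nat}.

Let coors (i : 'I_n) (x : 'rV[R]_n) : measurableTypeR R := x 0 i.

Let row_set0 : g_sigma_preimage coors set0.
Proof. exact: sigma_algebra0. Qed.

Let row_setC A : g_sigma_preimage coors A -> g_sigma_preimage coors (~` A).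
Proof. exact: sigma_algebraC. Qed.

Let row_bigcup (F : (set 'rV[R]_n)^nat) :
  (forall i, g_sigma_preimage coors (F i)) ->
  g_sigma_preimage coors (\bigcup_i (F i)).
Proof. exact: sigma_algebra_bigcup. Qed.

HB.instance Definition _ := @isMeasurable.Build (row_display default_measure_display)
  'rV[R]_n (g_sigma_preimage coors) row_set0 row_setC row_bigcup.

Lemma measurable_coord (i : 'I_n) :
  measurable_fun setT (fun x : 'rV[R]_n => x 0 i : measurableTypeR R).
Proof.
move=> _ Y mY; rewrite setTI; apply: sub_sigma_algebra => /=.
rewrite -bigcup_seq/=; exists i => /=; first by rewrite mem_index_enum.
by exists Y => //; rewrite setTI.
Qed.

Lemma measurable_fun_row d (T : measurableType d) (f : T -> 'rV[R]_n) :
  (forall i, measurable_fun setT (fun t => f t 0 i : measurableTypeR R)) ->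
  measurable_fun setT f.
Proof.
move=> mf.
have sub : g_sigma_preimage (fun i t => coors i (f t)) `<=` measurable.
  apply: smallest_sub; first exact: sigma_algebra_measurable.
  rewrite -bigcup_seq/= => B [i _] [A mA <-]; exact: mf.
move=> _ A mA; apply: sub.
rewrite (@g_sigma_preimage_comp _ _ _ _ coors _ f).
by exists A.
Qed.

End measurable_row.

(** Lebesgue measure on R^n, as the iterated product of [lebesgue_measure]. *)

Section lebesgue_row.
Context {R : realType}.

Definition row_cons {n} (p : measurableTypeR R * 'rV[R]_n) : 'rV[R]_n.+1 :=
  \row_i (if unlift ord0 i is Some j then p.2 0 j else p.1).

Definition row_uncons {n} (x : 'rV[R]_n.+1) : measurableTypeR R * 'rV[R]_n :=
  (x 0 ord0, \row_j x 0 (lift ord0 j)).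

Lemma row_consK n : cancel (@row_cons n) row_uncons.
Proof.
move=> [a x]; rewrite /row_uncons mxE unlift_none; congr (_, _).
by apply/rowP => j; rewrite !mxE liftK.
Qed.

Lemma row_unconsK n : cancel row_uncons (@row_cons n).
Proof.
move=> x; apply/rowP => i; rewrite mxE.
by case: unliftP => [j ->|->] //=; rewrite mxE.
Qed.

Lemma measurable_row_cons n : measurable_fun setT (@row_cons n).
Proof.
apply: measurable_fun_row => i; rewrite /row_cons.
case: (unliftP ord0 i) => [j|] ->.
  rewrite (_ : (fun _ => _) = (fun x : 'rV[R]_n => x 0 j) \o snd); last first.
    by apply/funext => p /=; rewrite mxE liftK.
  by apply: measurableT_comp => //; exact: measurable_coord.
rewrite (_ : (fun _ => _) = fst); first exact: measurable_fst.
by apply/funext => p /=; rewrite mxE unlift_none.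
Qed.

Lemma measurable_row_uncons n : measurable_fun setT (@row_uncons n).
Proof.
apply/measurable_fun_pairP; split; first exact: measurable_coord.
apply: measurable_fun_row => j; rewrite /row_uncons /=.
rewrite (_ : (fun _ => _) = (fun x : 'rV[R]_n.+1 => x 0 (lift ord0 j))).
  exact: measurable_coord.
by apply/funext => x /=; rewrite mxE.
Qed.

Section step.
Context (n : nat) (mu : {sigma_finite_measure set 'rV[R]_n -> \bar R}).
Local Open Scope ereal_scope.

Definition lebesgue_step : set 'rV[R]_n.+1 -> \bar R :=
  pushforward (lebesgue_measure \x mu) row_cons.

Let step0 : lebesgue_step set0 = 0.
Proof. by rewrite /lebesgue_step /pushforward preimage_set0 measure0. Qed.

Let step_ge0 A : 0 <= lebesgue_step A.
Proof. by rewrite /lebesgue_step /pushforward measure_ge0. Qed.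

Let step_sigma_additive : semi_sigma_additive lebesgue_step.
Proof.
move=> F mF tF mUF; rewrite /lebesgue_step /pushforward preimage_bigcup.
apply: measure_semi_sigma_additive.
- by move=> k; rewrite -[X in measurable X]setTI; exact: measurable_row_cons.
- apply/trivIsetP => /= i j _ _ ij; rewrite -preimage_setI.
  by move/trivIsetP : tF => /(_ _ _ _ _ ij) ->//; rewrite preimage_set0.
- rewrite -preimage_bigcup -[X in measurable X]setTI.
  exact: measurable_row_cons.
Qed.

HB.instance Definition _ := isMeasure.Build _ _ _ lebesgue_step
  step0 step_ge0 step_sigma_additive.

Let step_sigma_finite : sigma_finite setT lebesgue_step.
Proof.
have /sigma_finiteP[F [TF ndF Foo]] := sigma_finiteT (@lebesgue_measure R).
have /sigma_finiteP[G [TG ndG Goo]] := sigma_finiteT mu.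
exists (fun k => row_uncons @^-1` (F k `*` G k)) => [|k].
  rewrite -preimage_bigcup -(preimage_setT row_uncons); congr (_ @^-1` _).
  rewrite -setXTT TF TG predeqE => -[x y]; split.
    move=> [/= [i _ Fx] [j _ Gy]]; exists (maxn i j) => //; split.
    - by move: x Fx; exact/subsetPset/ndF/leq_maxl.
    - by move: y Gy; exact/subsetPset/ndG/leq_maxr.
  by move=> [i _ []/= ? ?]; split; exists i.
have [mF Fk] := Foo k; have [mG Gk] := Goo k.
have mFG : measurable (F k `*` G k) by exact: measurableX.
split; first by rewrite -[X in measurable X]setTI; exact: measurable_row_uncons.
rewrite /lebesgue_step /pushforward -comp_preimage.
rewrite (_ : _ \o _ = id); last by apply/funext => x /=; rewrite row_consK.
by rewrite product_measure1E// lte_mul_pinfty// ge0_fin_numE.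
Qed.

HB.instance Definition _ :=
  Measure_isSigmaFinite.Build _ _ _ lebesgue_step step_sigma_finite.

End step.

Fixpoint lebesgue_row (n : nat) : {sigma_finite_measure set 'rV[R]_n -> \bar R} :=
  match n return {sigma_finite_measure set 'rV[R]_n -> \bar R} with
  | 0 => dirac (0 : 'rV[R]_0)
  | m.+1 => lebesgue_step (lebesgue_row m)
  end.

End lebesgue_row.

(** The spherical Lebesgue measure of [A] is the dimension of the ambient space
    times the volume of the cone [{t *: u | 0 < t <= 1, u \in A}]. It is defined
    as a measure on the ambient space, concentrated on the unit sphere. *)

Section spherical_measure.
Context {R : realType} {n : nat}.

Definition punctured_ball : set 'rV[R]_n := [set x | 0 < enorm x <= 1].

Lemma measurable_enorm :
  measurable_fun setT (@enorm R n : 'rV[R]_n -> measurableTypeR R).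
Proof.
rewrite (_ : enorm = (@powR R ^~ 2^-1) \o (fun x => \sum_i x 0 i ^+ 2)).
  apply: (measurableT_comp (f := @powR R ^~ 2^-1)); first exact: measurable_powR.
  by apply: measurable_sum => i; apply: measurable_funX; exact: measurable_coord.
apply/funext => x /=; rewrite powR12_sqrt; last first.
  by apply: sumr_ge0 => i _; rewrite sqr_ge0.
rewrite /enorm /dot mxE; congr Num.sqrt.
by apply: eq_bigr => i _; rewrite mxE expr2.
Qed.

Lemma measurable_punctured_ball : measurable punctured_ball.
Proof.
rewrite (_ : punctured_ball = enorm @^-1` `]0, 1]); last first.
  by apply/seteqP; split => x /=; rewrite in_itv.
by rewrite -[X in measurable X]setTI; exact: measurable_enorm.
Qed.

Lemma measurable_normalize : measurable_fun setT (@normalize R n).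
Proof.
apply: measurable_fun_row => i.
rewrite (_ : (fun _ => _) =
  (fun x : 'rV[R]_n => enorm x `^ (-1) * x 0 i)); last first.
  by apply/funext => x; rewrite powR_inv1 ?sqrtr_ge0// /normalize mxE.
apply: measurable_funM; last exact: measurable_coord.
apply: (measurableT_comp (f := @powR R ^~ (-1))).
  exact: measurable_powR.
exact: measurable_enorm.
Qed.

Definition spherical_measure : set 'rV[R]_n -> \bar R :=
  fun A => (n%:R%:E * lebesgue_row n (normalize @^-1` A `&` punctured_ball))%E.

Local Open Scope ereal_scope.

Let spherical0 : spherical_measure set0 = 0.
Proof. by rewrite /spherical_measure preimage_set0 set0I measure0 mule0. Qed.

Let spherical_ge0 A : 0 <= spherical_measure A.
Proof. by rewrite /spherical_measure mule_ge0. Qed.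

Let spherical_sigma_additive : semi_sigma_additive spherical_measure.
Proof.
have mpre A : measurable A -> measurable (normalize @^-1` A : set 'rV[R]_n).
  by move=> mA; rewrite -[X in measurable X]setTI; exact: measurable_normalize.
move=> F mF tF mUF; rewrite /spherical_measure preimage_bigcup setI_bigcupl.
rewrite [X in X @ \oo --> _](_ : _ = (fun k => n%:R%:E * \sum_(0 <= i < k)
    lebesgue_row n (normalize @^-1` F i `&` punctured_ball))); last first.
  by apply/funext => k; rewrite ge0_sume_distrr.
apply: cvgeZl => //; apply: measure_semi_sigma_additive.
- by move=> k; apply: measurableI; [exact: mpre|exact: measurable_punctured_ball].
- apply/trivIsetP => /= i j _ _ ij; rewrite setIACA -preimage_setI.
  by move/trivIsetP : tF => /(_ _ _ _ _ ij) ->//; rewrite preimage_set0 set0I.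
- rewrite -setI_bigcupl -preimage_bigcup; apply: measurableI; first exact: mpre.
  exact: measurable_punctured_ball.
Qed.

HB.instance Definition _ := isMeasure.Build _ _ _ spherical_measure
  spherical0 spherical_ge0 spherical_sigma_additive.

End spherical_measure.

Section sphere.
Context {R : realType} {n : nat}.
Implicit Types (u v e : 'rV[R]_n) (A K : set 'rV[R]_n).

Definition unit_sphere : set 'rV[R]_n := [set u | enorm u = 1].
Definition hemisphere u : set 'rV[R]_n := [set v | unit_sphere v /\ 0 <= dot u v].
Definition great_subsphere u : set 'rV[R]_n :=
  unit_sphere `&` orthogonal_compl u.
Definition open_hemisphere u : set 'rV[R]_n :=
  rel_interior unit_sphere (hemisphere u).

Definition sph_convex A :=
  convex_row [set l *: u | l in [set l : R | 0 <= l] & u in A].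

Definition sph_convex_body K :=
  [/\ K `<=` unit_sphere, closed K, sph_convex K, K <> unit_sphere &
      rel_interior unit_sphere K !=set0].

Definition sph_proper K :=
  exists2 u, unit_sphere u & K `<=` open_hemisphere u.

Definition sph_reflection e v : 'rV[R]_n := - v + (2 * dot v e) *: e.

Definition sph_centrally_symmetric e K :=
  sph_reflection e @` K = K /\ K `<=` hemisphere e.

Definition sph_centroid A : 'rV[R]_n :=
  normalize (\row_i (\int[@spherical_measure R n]_(u in A) u 0 i)%R).

Definition is_sph_centroid_body e K L :=
  sph_convex_body L /\
  rel_boundary unit_sphere L =
    [set sph_centroid (K `&` hemisphere u) | u in great_subsphere e].

Definition gnomonic e v : 'rV[R]_n := (dot e v)^-1 *: v - e.

End sphere.

(** An orthonormal frame of the hyperplane [orthogonal_compl e], given by the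
    rows of [B], identifies it with R^n through the isometry [x |-> x *m B]. *)

Section hyperplane.
Context {R : realType} {n : nat}.

Definition orthonormal_frame (e : 'rV[R]_n.+1) (B : 'M[R]_(n, n.+1)) :=
  B *m B^T = 1%:M /\ B *m e^T = 0.

Lemma exists_orthonormal_frame (e : 'rV[R]_n.+1) :
  unit_sphere e -> exists B, orthonormal_frame e B.
Proof.
rewrite /unit_sphere /= => e1.
have ee : dot e e = 1.
  have : enorm e ^+ 2 = 1 by rewrite e1 expr1n.
  rewrite /enorm sqr_sqrtr// /dot mxE; apply: sumr_ge0 => i _.
  by rewrite mxE -expr2 sqr_ge0.
pose d : 'rV[R]_n.+1 := delta_mx 0 ord0.
have eeT : e *m e^T = 1%:M by rewrite [LHS]mx11_scalar -/(dot e e) ee.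
have ddT : d *m d^T = 1%:M.
  rewrite [LHS]mx11_scalar mxE (bigD1 ord0)//= big1 => [|i i0].
    by rewrite !mxE !eqxx mulr1 addr0.
  by rewrite !mxE (negbTE i0) andbF mul0r.
have edT : e *m d^T = (e 0 ord0)%:M.
  rewrite [LHS]mx11_scalar mxE (bigD1 ord0)//= big1 => [|i i0].
    by rewrite !mxE !eqxx mulr1 addr0.
  by rewrite !mxE (negbTE i0) andbF mulr0.
have deT : d *m e^T = (e 0 ord0)%:M.
  by rewrite -[LHS]trmxK trmx_mul trmxK edT tr_scalar_mx.
pose w := e - d.
pose c := 1 - e 0 ord0.
have wwT : w *m w^T = (2 * c)%:M.
  rewrite /w linearB/= mulmxBl !mulmxBr eeT ddT edT deT -!raddfB /=; congr _%:M.
  rewrite /c; ring.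
have [H [HT HH eH]] : exists H : 'M[R]_n.+1, [/\ H^T = H, H *m H = 1%:M & e *m H = d].
  have [c0|c0] := eqVneq c 0.
    have w0 : w = 0.
      have : \sum_i w 0 i ^+ 2 = 0.
        have /(congr1 (fun M : 'M[R]_1 => M 0 0)) := wwT.
        rewrite c0 mulr0 [LHS]mxE [RHS]mxE mul0rn => ww0.
        by rewrite -[RHS]ww0; apply: eq_bigr => i _; rewrite [w^T _ _]mxE expr2.
      move/eqP; rewrite psumr_eq0 => [/allP h|i _]; last exact: sqr_ge0.
      apply/rowP => i; rewrite [RHS]mxE; apply/eqP.
      by rewrite -sqrf_eq0; exact: h i (mem_index_enum _).
    exists 1%:M; split; rewrite ?trmx1 ?mulmx1//.
    by apply/eqP; rewrite -subr_eq0 -/w w0.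
  exists (1%:M - c^-1 *: (w^T *m w)); split.
  - by rewrite linearB/= trmx1 linearZ/= trmx_mul trmxK.
  - have PP : (w^T *m w) *m (w^T *m w) = (2 * c) *: (w^T *m w).
      by rewrite mulmxA -(mulmxA w^T) wwT mul_mx_scalar -scalemxAl.
    set P := w^T *m w in PP *.
    rewrite mulmxBl mul1mx mulmxBr mulmx1 -scalemxAl -scalemxAr PP !scalerA.
    rewrite (_ : c^-1 * c^-1 * (2 * c) = c^-1 + c^-1); last by field.
    by rewrite scalerDl opprB addrK subrK.
  - have ewT : e *m w^T = c%:M.
      by rewrite linearB/= mulmxBr eeT edT -raddfB.
    rewrite mulmxBr mulmx1 -scalemxAr mulmxA ewT mul_scalar_mx scalerA.
    by rewrite mulVf// scale1r opprB addrC subrK.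
exists (rowsub (lift ord0) H); split.
  rewrite trmx_mxsub HT -mxsub_mul HH.
  by apply/matrixP => i j; rewrite !mxE (inj_eq lift_inj).
rewrite mul_rowsub_mx -{1}HT -trmx_mul eH.
by apply/matrixP => i j; rewrite !mxE [lift _ _ == _]eq_sym (negbTE (neq_lift _ _)) andbF.
Qed.

Section hyperplane_measure.
Context (B : 'M[R]_(n, n.+1)).

Lemma measurable_mulmx_row :
  measurable_fun setT (fun x : 'rV[R]_n => x *m B).
Proof.
apply: measurable_fun_row => i.
rewrite (_ : (fun _ => _) = (fun x : 'rV[R]_n => \sum_j x 0 j * B j i)).
  apply: measurable_sum => j; apply: measurable_funM; first exact: measurable_coord.
  exact: measurable_cst.
by apply/funext => x; rewrite mxE.
Qed.

(** For an orthonormal frame [B] of the hyperplane [orthogonal_compl e], this is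
    the Lebesgue measure of the hyperplane. *)
Definition hyperplane_lebesgue : set 'rV[R]_n.+1 -> \bar R :=
  pushforward (lebesgue_row n) (fun x : 'rV[R]_n => x *m B).

Local Open Scope ereal_scope.

Let hyperplane0 : hyperplane_lebesgue set0 = 0.
Proof. by rewrite /hyperplane_lebesgue /pushforward preimage_set0 measure0. Qed.

Let hyperplane_ge0 A : 0 <= hyperplane_lebesgue A.
Proof. by rewrite /hyperplane_lebesgue /pushforward measure_ge0. Qed.

Let hyperplane_sigma_additive : semi_sigma_additive hyperplane_lebesgue.
Proof.
move=> F mF tF mUF; rewrite /hyperplane_lebesgue /pushforward preimage_bigcup.
apply: measure_semi_sigma_additive.
- by move=> k; rewrite -[X in measurable X]setTI; exact: measurable_mulmx_row.
- apply/trivIsetP => /= i j _ _ ij; rewrite -preimage_setI.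
  by move/trivIsetP : tF => /(_ _ _ _ _ ij) ->//; rewrite preimage_set0.
- rewrite -preimage_bigcup -[X in measurable X]setTI.
  exact: measurable_mulmx_row.
Qed.

HB.instance Definition _ := isMeasure.Build _ _ _ hyperplane_lebesgue
  hyperplane0 hyperplane_ge0 hyperplane_sigma_additive.

Definition tau_density (x : 'rV[R]_n.+1) : R :=
  ((1 + enorm x ^+ 2) `^ (- (n.+2%:R / 2)))%R.

Lemma measurable_tau_density : measurable_fun setT (tau_density : _ -> measurableTypeR R).
Proof.
apply: (measurableT_comp (f := @powR R ^~ (- (n.+2%:R / 2))%R)).
  exact: measurable_powR.
apply: measurable_funD; first exact: measurable_cst.
by apply: measurable_funX; exact: measurable_enorm.
Qed.

Definition tau_hat (A : set 'rV[R]_n.+1) : \bar R :=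
  \int[hyperplane_lebesgue]_(x in A) (tau_density x)%:E.

Let tau_hat0 : tau_hat set0 = 0.
Proof. by rewrite /tau_hat integral_set0. Qed.

Let tau_hat_ge0 A : 0 <= tau_hat A.
Proof. by apply: integral_ge0 => x _; rewrite lee_fin powR_ge0. Qed.

Let tau_hat_sigma_additive : semi_sigma_additive tau_hat.
Proof.
move=> F mF tF mUF; rewrite /tau_hat ge0_integral_bigcup//=; last 2 first.
- apply: (measurable_funS measurableT) => //.
  by apply/measurable_EFinP; exact: measurable_tau_density.
- by move=> x _; rewrite lee_fin powR_ge0.
apply: is_cvg_ereal_nneg_natsum_cond => k _ _.
by apply: integral_ge0 => x _; rewrite lee_fin powR_ge0.
Qed.

HB.instance Definition _ := isMeasure.Build _ _ _ tau_hat
  tau_hat0 tau_hat_ge0 tau_hat_sigma_additive.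

End hyperplane_measure.

(** [L] is the convex body of the hyperplane [orthogonal_compl e] with the
    support function of the [tau_hat]-centroid body of [M]. The supremum defining
    [support_function] is a maximum since [L] is compact and nonempty. *)
Definition is_tau_centroid_body (e : 'rV[R]_n.+1) (B : 'M[R]_(n, n.+1))
    (M L : set 'rV[R]_n.+1) :=
  [/\ L `<=` orthogonal_compl e, compact L, convex_row L,
      rel_interior (orthogonal_compl e) L !=set0 &
      forall u, orthogonal_compl e u ->
        support_function L u =
          (fine (tau_hat B M))^-1 * (\int[tau_hat B]_(y in M) `|dot u y|)%R].

End hyperplane.

(* Main.v *)
(** With [width K w], the integral of [|w . v|] over [K], and [half_moment K u],
    the integral of [v] over the half [K `&` hemisphere u], the candidate body is
    the cone [|w . x| * width K e <= width K w * (e . x)] for all [w] orthogonal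
    to [e], intersected with the sphere. Since [K] is symmetric about [e], its
    two halves contribute equally, so [half_moment K u] is a point of the cone
    where the constraint of direction [u] is an equality. Conversely, comparing
    support values in the directions [u] and [u + t z] as [t -> 0] shows that it
    is the only such point up to scaling, hence the boundary is as prescribed.
    A convex body with this boundary avoids the hemisphere opposite to [e], so
    every point of it lies between two boundary points, which gives uniqueness.
    The gnomonic formula is integration in the coordinates [x = t (e + y)], which
    needs the orthogonal invariance and the scaling of the iterated product
    measure [lebesgue_row]. *)
Require Import Defs.
From mathcomp Require Import all_boot all_order all_algebra.
From mathcomp Require Import interval_inference ring lra.
From mathcomp Require Import all_classical all_reals all_analysis.
From mathcomp Require Import measurable_realfun.

Set Implicit Arguments.
Unset Strict Implicit.
Unset Printing Implicit Defensive.

Import Order.TTheory GRing.Theory Num.Theory.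
Import numFieldNormedType.Exports.

Local Open Scope classical_set_scope.
Local Open Scope ring_scope.

(** * Integration against the iterated Lebesgue measure *)

(** Why this cone: in the coordinates [x = t (e + y)] the Jacobian contributes [|e + y|^-(n+1)], and
    a function homogeneous of degree 1 contributes one more power through normalization. Together
    they are the density of [tau_hat]. Taking [|w . x|] with [w] orthogonal to [e] gives [|w . y|],
    and taking [w = e] gives the total mass. So [width K w / width K e] is the prescribed support
    function, and the body on the sphere and its gnomonic image are two views of one family of
    linear inequalities. The delicate point is that each support direction touches the body in a
    single ray. No derivative of [width] is taken: moments of the halves of [u] and [u'] differ by
    at most the measure of a slab of [K] around the orthogonal complement of [u], and these slabs
    shrink to a null set. Uniqueness of the body is a separate matter, since the prescribed boundary
    alone does not say on which side of it the body lies. *)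

Section weighted_pushforward.
Local Open Scope ereal_scope.
Context d1 d2 (X : measurableType d1) (Y : measurableType d2) (R : realType).
Variables (mu : {measure set X -> \bar R}) (nu : {measure set Y -> \bar R}).
Variables (phi : X -> Y) (k : X -> R).
Hypothesis mphi : measurable_fun setT phi.
Hypothesis mk : measurable_fun setT k.
Hypothesis k0 : forall x, (0 <= k x)%R.
Hypothesis nuE : forall A, measurable A ->
  nu A = \int[mu]_x ((k x)%:E * (\1_A (phi x))%:E).

Import HBNNSimple.

(** [nuE] is the case of indicators; linearity gives simple functions and monotone convergence the
    rest. It serves for three measures given by a weight and a map: the rescaled line, the sphere
    and the weighted hyperplane. *)
Lemma ge0_integral_weighted (f : Y -> \bar R) : measurable_fun setT f ->
  (forall y, 0 <= f y) -> \int[nu]_y f y = \int[mu]_x ((k x)%:E * f (phi x)).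
Proof.
move=> mf f0; pose f_ := nnsfun_approx measurableT mf.
have mkf n : measurable_fun setT (fun x => (k x)%:E * (f_ n (phi x))%:E).
  apply: emeasurable_funM; first exact/measurable_EFinP; apply/measurable_EFinP.
  exact: measurableT_comp.
transitivity (limn (fun n => \int[nu]_x (f_ n x)%:E)).
  rewrite -monotone_convergence//.
  - apply: eq_integral => y _; apply/esym/cvg_lim => //.
    exact: cvg_nnsfun_approx.
  - by move=> n; exact/measurable_EFinP/measurable_funP.
  - by move=> n y _; rewrite lee_fin.
  - by move=> y _ m n mn; rewrite lee_fin; exact/lefP/nd_nnsfun_approx.
rewrite [X in limn X](_ : _ =
    (fun n => \int[mu]_x ((k x)%:E * (f_ n (phi x))%:E))).
  rewrite -monotone_convergence//.
  - apply: eq_integral => x _; apply/cvg_lim => //.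
    apply: cvgeZl => //; exact: cvg_nnsfun_approx.
  - by move=> n x _; rewrite mule_ge0 ?lee_fin// lee_fin.
  - move=> x _ m n mn; apply: lee_pmul => //; rewrite lee_fin//.
    exact/lefP/nd_nnsfun_approx.
apply/funext => n.
have m1 r : measurable_fun setT (fun x => (k x)%:E * (r * \1_(f_ n @^-1` [set r]) (phi x))%:E).
  apply: emeasurable_funM; first exact/measurable_EFinP; apply/measurable_EFinP.
  apply: measurable_funM => //; apply: measurableT_comp => //.
under eq_integral do rewrite fimfunE -fsumEFin//.
rewrite ge0_integral_fsum//; last 2 first.
- by move=> y; exact/measurable_EFinP/measurable_funM.
- by move=> y x _; exact: nnfun_muleindic_ge0.
transitivity (\sum_(r \in range (f_ n))
   \int[mu]_x ((k x)%:E * (r * \1_(f_ n @^-1` [set r]) (phi x))%:E)).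
  apply: eq_fsbigr => r; rewrite inE => -[x _ xr].
  rewrite integralZl_indic_nnsfun// integral_indic// setIT nuE//.
  rewrite -ge0_integralZl//.
  - by apply: eq_integral => z _; rewrite muleCA EFinM.
  - apply: emeasurable_funM; first exact/measurable_EFinP; apply/measurable_EFinP.
    exact: measurableT_comp.
  - by move=> z _; rewrite mule_ge0 ?lee_fin// lee_fin.
  - by rewrite lee_fin -xr.
rewrite -ge0_integral_fsum//.
- apply: eq_integral => x _; rewrite fimfunE -fsumEFin//.
  rewrite ge0_mule_fsumr// => r; exact: nnfun_muleindic_ge0.
- move=> r x _; apply: mule_ge0; first by rewrite lee_fin.
  exact: nnfun_muleindic_ge0.
Qed.

End weighted_pushforward.

Section measurable_row_operations.
Context {R : realType} {d} {T : measurableType d}.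

Lemma measurable_row_coord n (f : T -> 'rV[R]_n) i : measurable_fun setT f ->
  measurable_fun setT (fun t => f t 0 i : measurableTypeR R).
Proof. by move=> mf; exact: (measurableT_comp (measurable_coord i) mf). Qed.

Lemma measurable_rowD n (f g : T -> 'rV[R]_n) : measurable_fun setT f ->
  measurable_fun setT g -> measurable_fun setT (fun t => f t + g t).
Proof.
move=> mf mg; apply: measurable_fun_row => i.
rewrite (_ : (fun _ => _) = (fun t => f t 0 i + g t 0 i)); last first.
  by apply/funext => t; rewrite mxE.
by apply: measurable_funD; exact: measurable_row_coord.
Qed.

Lemma measurable_rowZ n (k : T -> R) (f : T -> 'rV[R]_n) :
  measurable_fun setT k -> measurable_fun setT f ->
  measurable_fun setT (fun t => k t *: f t).
Proof.
move=> mk mf; apply: measurable_fun_row => i.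
rewrite (_ : (fun _ => _) = (fun t => k t * f t 0 i)); last first.
  by apply/funext => t; rewrite mxE.
by apply: measurable_funM => //; exact: measurable_row_coord.
Qed.

Lemma measurable_row_mulmx m n (M : 'M[R]_(m, n)) (f : T -> 'rV[R]_m) :
  measurable_fun setT f -> measurable_fun setT (fun t => f t *m M).
Proof.
move=> mf; apply: measurable_fun_row => i.
rewrite (_ : (fun _ => _) = (fun t => \sum_j f t 0 j * M j i)); last first.
  by apply/funext => t; rewrite mxE.
apply: measurable_sum => j; apply: measurable_funM => //.
exact: measurable_row_coord.
Qed.

Lemma measurable_dot n (w : 'rV[R]_n) (f : T -> 'rV[R]_n) :
  measurable_fun setT f -> measurable_fun setT (fun t => dot w (f t)).
Proof.
move=> mf; rewrite (_ : (fun _ => _) = (fun t => \sum_j w 0 j * f t 0 j)).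
  by apply: measurable_sum => j; apply: measurable_funM => //;
     exact: measurable_row_coord.
by apply/funext => t; rewrite /dot mxE; apply: eq_bigr => j _; rewrite mxE.
Qed.

Lemma measurable_row_cons_comp n (f : T -> R) (g : T -> 'rV[R]_n) :
  measurable_fun setT f -> measurable_fun setT g ->
  measurable_fun setT (fun t => row_cons (f t, g t)).
Proof.
move=> mf mg; apply: (measurableT_comp (@measurable_row_cons _ _)) => /=.
exact: measurable_fun_pair.
Qed.

End measurable_row_operations.

Lemma measurable_orthogonal_compl (R : realType) n (w : 'rV[R]_n) :
  measurable (orthogonal_compl w).
Proof.
rewrite (_ : orthogonal_compl w = dot w @^-1` [set 0])//.
rewrite -[X in measurable X]setTI.
exact: (@measurable_dot _ _ _ _ w (fun x => x)).
Qed.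

Section lebesgue_row_affine.
Context {R : realType}.
Local Open Scope ereal_scope.

(** Uniqueness of Lebesgue measure: [a] times the image measure under [x |-> a * x + c] gives every
    half-open interval its length. *)
Lemma ge0_integral_lebesgue_affine (a c : R) (f : R -> \bar R) : (0 < a)%R ->
  measurable_fun setT f -> (forall x, 0 <= f x) ->
  \int[@lebesgue_measure R]_x f x =
  a%:E * \int[@lebesgue_measure R]_x f (a * x + c)%R.
Proof.
move=> a0 mf f0.
pose phi (x : measurableTypeR R) : measurableTypeR R := (a * x + c)%R.
have mphi : measurable_fun setT phi.
  by apply: measurable_funD => //; apply: measurable_funM.
have phiE A : measurable A -> lebesgue_measure A =
    a%:E * pushforward lebesgue_measure phi A.
  move=> mA; apply: (@lebesgue_measure_unique R
    (mscale (NngNum (ltW a0)) (pushforward lebesgue_measure phi))) => //= _ [[x y]] _ <-.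
  rewrite /mscale/= /pushforward.
  have -> : phi @^-1` `]x, y]%classic = `]((x - c) / a)%R, ((y - c) / a)%R]%classic.
    apply/seteqP; split => z /=;
      by rewrite !in_itv/= ltr_pdivrMr// ler_pdivlMr// ltrBlDr lerBrDr /phi mulrC.
  rewrite !lebesgue_measure_itv/= !lte_fin ltr_pM2r ?invr_gt0// ltrD2r.
  case: ifPn => _; last by rewrite mule0.
  rewrite -!EFinB -EFinM; congr _%:E; field; exact: lt0r_neq0.
rewrite (@ge0_integral_weighted _ _ _ _ _ lebesgue_measure lebesgue_measure
  phi (fun=> a))//; last 2 first.
- by move=> _; exact: ltW.
- move=> A mA; transitivity (a%:E * pushforward lebesgue_measure phi A).
    exact: phiE.
  rewrite ge0_integralZl//=; last 2 first.
  + apply/measurable_EFinP; exact: measurableT_comp.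
  + by rewrite lee_fin ltW.
  rewrite (_ : (fun x => _) = EFin \o \1_(phi @^-1` A)); last exact/funext.
  rewrite integral_indic ?setIT//.
  by rewrite -[X in measurable X]setTI; exact: mphi.
rewrite ge0_integralZl//.
- exact: (measurableT_comp mf).
- by rewrite lee_fin ltW.
Qed.

Lemma ge0_integral_row0 (f : 'rV[R]_0 -> \bar R) : measurable_fun setT f ->
  \int[lebesgue_row 0]_x f x = f (0 : 'rV[R]_0)%R.
Proof. by move=> mf; rewrite integral_dirac// diracT mul1e. Qed.

Lemma ge0_integral_rowS n (f : 'rV[R]_n.+1 -> \bar R) :
  measurable_fun setT f -> (forall x, 0 <= f x) ->
  \int[lebesgue_row n.+1]_x f x =
  \int[@lebesgue_measure R]_t \int[lebesgue_row n]_y f (row_cons (t, y)).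
Proof.
move=> mf f0.
rewrite [LHS](@ge0_integral_pushforward _ _ _ _ _ _
  (@measurable_row_cons R n) (lebesgue_measure \x lebesgue_row n))//.
rewrite fubini_tonelli1//.
  by apply: (measurableT_comp mf); exact: measurable_row_cons.
by move=> x; exact: f0.
Qed.

Lemma row_cons_affine n (a t s : R) (x y : 'rV[R]_n) :
  (a *: row_cons (t, x) + row_cons (s, y))%R =
  row_cons ((a * t + s)%R, (a *: x + y)%R).
Proof.
apply/rowP => i; rewrite !mxE; case: unliftP => [j _|_] //=.
by rewrite !mxE.
Qed.

(** Each coordinate contributes one factor [a]. The induction ranges over all [c], because the tail
    of [c] translates the remaining coordinates. *)
Lemma ge0_integral_row_affine n (a : R) (c : 'rV[R]_n) (f : 'rV[R]_n -> \bar R) :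
  (0 < a)%R -> measurable_fun setT f -> (forall x, 0 <= f x) ->
  \int[lebesgue_row n]_x f x =
  (a ^+ n)%:E * \int[lebesgue_row n]_x f (a *: x + c)%R.
Proof.
elim: n c f => [|n IH] c f a0 mf f0.
  rewrite !ge0_integral_row0//.
    by rewrite expr0 mul1e; congr f; apply/rowP => -[].
  apply: (measurableT_comp mf); apply: measurable_rowD => //.
  exact: measurable_rowZ.
have maff : measurable_fun setT (fun x : 'rV[R]_n.+1 => a *: x + c)%R.
  by apply: measurable_rowD => //; exact: measurable_rowZ.
rewrite !ge0_integral_rowS//; last exact: measurableT_comp.
have mrow t : measurable_fun setT (fun y => f (row_cons (t, y))).
  by apply: (measurableT_comp mf); exact: measurable_row_cons_comp.
have mF : measurable_fun setT
    (fun t : R => \int[lebesgue_row n]_y f (row_cons (t, y))).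
  apply: (@measurable_fun_fubini_tonelli_F _ _ _ _ _ (lebesgue_row n)
    (f \o @row_cons R n)) => [|p]; last exact: f0.
  by apply: (measurableT_comp mf); exact: measurable_row_cons.
have F0 t : 0 <= \int[lebesgue_row n]_y f (row_cons (t, y)).
  by apply: integral_ge0.
rewrite -[c](row_unconsK c) /row_uncons.
set s := (c 0 ord0)%R; set c' := (\row_j _)%R.
under [in RHS]eq_integral do under eq_integral do rewrite row_cons_affine.
rewrite (ge0_integral_lebesgue_affine s a0 mF F0) exprS EFinM -muleA; congr (_ * _).
rewrite [LHS](eq_integral (fun t : measurableTypeR R => (a ^+ n)%:E *
    \int[lebesgue_row n]_y f (row_cons ((a * t + s)%R, (a *: y + c')%R)))).
  2: by move=> t _; exact: (IH c' _ a0 (mrow _) (fun=> f0 _)).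
rewrite ge0_integralZl//.
- apply: (@measurable_fun_fubini_tonelli_F _ _ _ _ _ (lebesgue_row n)
    (fun p => f (row_cons ((a * p.1 + s)%R, (a *: p.2 + c')%R)))) => [|p]; last exact: f0.
  apply: (measurableT_comp mf); apply: measurable_row_cons_comp.
    by apply: measurable_funD => //; apply: measurable_funM.
  by apply: measurable_rowD => //; exact: measurable_rowZ.
- by move=> t _; apply: integral_ge0.
- by rewrite lee_fin exprn_ge0// ltW.
Qed.

Lemma ge0_integral_row_translate n (c : 'rV[R]_n) (f : 'rV[R]_n -> \bar R) :
  measurable_fun setT f -> (forall x, 0 <= f x) ->
  \int[lebesgue_row n]_x f (x + c)%R = \int[lebesgue_row n]_x f x.
Proof.
move=> mf f0; rewrite [RHS](ge0_integral_row_affine c ltr01)// expr1n mul1e.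
by apply: eq_integral => x _; rewrite scale1r.
Qed.

(** A closed ball of the sup norm. Its product measure is explicit, so it serves to bound other sets
    from inside and from outside. *)
Definition row_box n (r : R) : set 'rV[R]_n :=
  [set x | forall i, (`|x 0 i| <= r)%R].

Lemma measurable_row_box n (r : R) : measurable (row_box r : set 'rV[R]_n).
Proof.
rewrite (_ : row_box r = \bigcap_(i in [set: 'I_n])
    ((fun x : 'rV[R]_n => x 0 i)%R @^-1` `[(- r)%R, r]%classic)).
  apply: fin_bigcap_measurable => // i _; rewrite -[X in measurable X]setTI.
  exact: measurable_coord.
apply/seteqP; split => x h i; last by have := h i Logic.I; rewrite /= in_itv/= ler_norml.
by move=> _; have := h i; rewrite /= in_itv/= ler_norml.
Qed.

Lemma lebesgue_row_box n (r : R) : (0 <= r)%R ->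
  lebesgue_row n (row_box r) = ((2 * r) ^+ n)%:E.
Proof.
move=> r0; elim: n => [|n IH].
  by rewrite /= diracE mem_set ?expr0//= => -[].
transitivity ((lebesgue_measure \x lebesgue_row n)
    (`[(- r)%R, r]%classic `*` row_box r)).
  have -> : `[(- r)%R, r]%classic `*` row_box r =
      @row_cons R n @^-1` row_box r; last by [].
  apply/seteqP; split => -[t y]; rewrite /row_box/=; last first.
    move=> h; split; first by have := h ord0; rewrite mxE unlift_none in_itv/= ler_norml.
    by move=> i; have := h (lift ord0 i); rewrite mxE liftK.
  rewrite in_itv/= -ler_norml => -[ht hy] i; rewrite mxE.
  by case: unliftP.
rewrite product_measure1E//; last exact: measurable_row_box.
rewrite [X in _ * X]IH [X in X * _]lebesgue_measure_itv/= lte_fin.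
have [rr|rr] := ltP (- r)%R r.
  by rewrite -EFinB -EFinM exprS; congr (_ * _)%:E; ring.
have -> : r = 0%R by lra.
by rewrite mulr0 exprS mul0r mul0e.
Qed.

End lebesgue_row_affine.

(** * Euclidean geometry *)

Section euclidean_theory.
Context {R : realType} {n : nat}.
Implicit Types (u v w x y : 'rV[R]_n) (a b t : R).

Lemma dotE u v : dot u v = \sum_i u 0 i * v 0 i.
Proof. by rewrite /dot mxE; apply: eq_bigr => i _; rewrite mxE. Qed.

Lemma dotC u v : dot u v = dot v u.
Proof. by rewrite !dotE; apply: eq_bigr => i _; rewrite mulrC. Qed.

Lemma dotDr w u v : dot w (u + v) = dot w u + dot w v.
Proof. by rewrite /dot linearD/= mulmxDr mxE. Qed.

Lemma dotDl w u v : dot (u + v) w = dot u w + dot v w.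
Proof. by rewrite dotC dotDr !(dotC w). Qed.

Lemma dotZr t w u : dot w (t *: u) = t * dot w u.
Proof. by rewrite /dot linearZ/= -scalemxAr mxE. Qed.

Lemma dotZl t w u : dot (t *: w) u = t * dot w u.
Proof. by rewrite dotC dotZr dotC. Qed.

Lemma dotNr w u : dot w (- u) = - dot w u.
Proof. by rewrite -scaleN1r dotZr mulN1r. Qed.

Lemma dotNl w u : dot (- w) u = - dot w u.
Proof. by rewrite dotC dotNr dotC. Qed.

Lemma dot0r w : dot w 0 = 0.
Proof. by rewrite -(scale0r 0) dotZr mul0r. Qed.

Lemma dot0l w : dot 0 w = 0.
Proof. by rewrite dotC dot0r. Qed.

Lemma dot_ge0 u : 0 <= dot u u.
Proof. by rewrite dotE sumr_ge0// => i _; rewrite -expr2 sqr_ge0. Qed.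

Lemma enorm_ge0 u : 0 <= enorm u.
Proof. exact: sqrtr_ge0. Qed.

Lemma enorm_sqr u : enorm u ^+ 2 = dot u u.
Proof. by rewrite /enorm sqr_sqrtr// dot_ge0. Qed.

Lemma coord_le_enorm u i : `|u 0 i| <= enorm u.
Proof.
rewrite /enorm -sqrtr_sqr ler_sqrt ?dot_ge0// dotE (bigD1 i)//= -expr2 lerDl.
by rewrite sumr_ge0// => j _; rewrite -expr2 sqr_ge0.
Qed.

Lemma enorm_eq0 u : (enorm u == 0) = (u == 0).
Proof.
apply/eqP/eqP => [u0|->]; last by rewrite /enorm dot0r sqrtr0.
apply/rowP => i; apply/eqP; rewrite mxE -normr_le0 -u0; exact: coord_le_enorm.
Qed.

Lemma enorm_gt0 u : (0 < enorm u) = (u != 0).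
Proof. by rewrite lt_neqAle enorm_ge0 andbT eq_sym enorm_eq0. Qed.

Lemma dot_gt0 u : (0 < dot u u) = (u != 0).
Proof. by rewrite -enorm_sqr exprn_even_gt0//= enorm_eq0. Qed.

Lemma enormZ t u : enorm (t *: u) = `|t| * enorm u.
Proof.
by rewrite /enorm dotZr dotZl mulrA -expr2 sqrtrM ?sqr_ge0// sqrtr_sqr.
Qed.

Lemma cauchy_schwarz_sqr u v : dot u v ^+ 2 <= dot u u * dot v v.
Proof.
have [->|v0] := eqVneq v 0; first by rewrite !dot0r expr0n/= mulr0.
have := dot_ge0 (dot v v *: u - dot u v *: v).
rewrite dotDl !dotDr !dotNl !dotNr !dotZl !dotZr (dotC v u).
set a := dot u u; set b := dot u v; set c := dot v v => h.
have c0 : 0 < c by rewrite /c dot_gt0.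
rewrite -subr_ge0 -(pmulr_rge0 _ c0); apply: le_trans h _.
by rewrite le_eqVlt; apply/orP; left; apply/eqP; ring.
Qed.

Lemma cauchy_schwarz u v : `|dot u v| <= enorm u * enorm v.
Proof.
rewrite -(ler_pXn2r (n := 2)) ?nnegrE ?mulr_ge0 ?enorm_ge0//.
by rewrite exprMn !enorm_sqr real_normK ?num_real ?cauchy_schwarz_sqr.
Qed.

Lemma unit_sphere_dot u : unit_sphere u -> dot u u = 1.
Proof. by rewrite /unit_sphere/= => u1; rewrite -enorm_sqr u1 expr1n. Qed.

Lemma unit_sphere_neq0 u : unit_sphere u -> u != 0.
Proof. by rewrite /unit_sphere/= -enorm_gt0 => ->. Qed.

Lemma unit_sphere_dotP u : dot u u = 1 -> unit_sphere u.
Proof. by rewrite /unit_sphere /enorm/= => ->; rewrite sqrtr1. Qed.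

Lemma enorm_normalize u : u != 0 -> unit_sphere (normalize u).
Proof.
move=> u0; rewrite /unit_sphere/= enormZ ger0_norm ?invr_ge0 ?enorm_ge0//.
by rewrite mulVf// enorm_eq0.
Qed.

Lemma normalize_unit u : unit_sphere u -> normalize u = u.
Proof. by rewrite /unit_sphere /normalize/= => ->; rewrite invr1 scale1r. Qed.

Lemma normalizeZ t u : 0 < t -> normalize (t *: u) = normalize u.
Proof.
move=> t0; rewrite /normalize enormZ gtr0_norm// invfM scalerA mulrAC.
by rewrite mulVf ?mul1r// gt_eqF.
Qed.

Lemma dot_normalize w u : dot w (normalize u) = (enorm u)^-1 * dot w u.
Proof. exact: dotZr. Qed.

Lemma scale_normalize u : u = enorm u *: normalize u.
Proof.
have [->|u0] := eqVneq u 0; first by rewrite /normalize !scaler0.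
by rewrite /normalize scalerA divff ?scale1r// enorm_eq0.
Qed.

End euclidean_theory.

Section orthogonal_matrix.
Context {R : realType}.

Lemma dot_mulmx m n (Q : 'M[R]_(m, n)) x y :
  Q *m Q^T = 1%:M -> dot (x *m Q) (y *m Q) = dot x y.
Proof.
by move=> QQ; rewrite /dot trmx_mul mulmxA -(mulmxA x) QQ mulmx1.
Qed.

Lemma enorm_mulmx m n (Q : 'M[R]_(m, n)) x :
  Q *m Q^T = 1%:M -> enorm (x *m Q) = enorm x.
Proof. by move=> QQ; rewrite /enorm dot_mulmx. Qed.

Lemma normalize_mulmx m n (Q : 'M[R]_(m, n)) x :
  Q *m Q^T = 1%:M -> normalize (x *m Q) = normalize x *m Q.
Proof. by move=> QQ; rewrite /normalize enorm_mulmx// scalemxAl. Qed.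

End orthogonal_matrix.

(** * Orthogonal invariance *)

Section lebesgue_row_orthogonal.
Context {R : realType} {n : nat}.
Local Open Scope ereal_scope.

Let unit_ball : set 'rV[R]_n := [set x | (enorm x <= 1)%R].

Let measurable_unit_ball : measurable unit_ball.
Proof.
rewrite (_ : unit_ball = @enorm R n @^-1` `]-oo, 1%R]%classic); last first.
  by apply/seteqP; split => x /=; rewrite in_itv.
by rewrite -[X in measurable X]setTI; exact: measurable_enorm.
Qed.

Let unit_ball_fin : lebesgue_row n unit_ball < +oo.
Proof.
apply: (@le_lt_trans _ _ (lebesgue_row n (row_box 1%R))); last first.
  by rewrite lebesgue_row_box// ltry.
apply: le_measure; rewrite ?inE//; first exact: measurable_row_box.
by move=> x x1 i; rewrite (le_trans (coord_le_enorm _ _)).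
Qed.

Let unit_ball_gt0 : 0 < lebesgue_row n unit_ball.
Proof.
(* Points of the cube satisfy [dot x x <= n r^2 <= 1]; [n + 1] instead of [n] keeps [r] positive in
   dimension 0. *)
pose r : R := (n.+1%:R^-1)%R.
have r0 : (0 < r)%R by rewrite invr_gt0 ltr0n.
apply: (@lt_le_trans _ _ (lebesgue_row n (row_box r))).
  by rewrite lebesgue_row_box ?(ltW r0)// lte_fin exprn_gt0// mulr_gt0.
apply: le_measure; rewrite ?inE//; first exact: measurable_row_box.
move=> x xr; rewrite /unit_ball/= -[leRHS]sqrtr1 /enorm ler_sqrt//.
rewrite dotE (@le_trans _ _ (\sum_(i < n) r ^+ 2)%R)//.
  by apply: ler_sum => i _; rewrite -expr2 -real_normK ?num_real// ler_pXn2r ?nnegrE ?(ltW r0).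
rewrite sumr_const card_ord -[leLHS]mulr_natl expr2 mulrA.
have nr : (n%:R * r <= 1)%R by rewrite ler_pdivrMr ?ltr0n// mul1r ler_nat.
rewrite mulr_ile1 ?mulr_ge0 ?(ltW r0)//.
by rewrite invf_le1 ?ltr0n// ler1n.
Qed.

(* Averaging [f] over the unit ball, which is invariant under [Q]: by Tonelli
   and translation invariance the value does not depend on [Q]. *)
Let average (Q : 'M[R]_n) (f : 'rV[R]_n -> \bar R) : Q *m Q^T = 1%:M ->
  measurable_fun setT f -> (forall x, 0 <= f x) ->
  \int[lebesgue_row n]_x f (x *m Q) * lebesgue_row n unit_ball =
  lebesgue_row n unit_ball * \int[lebesgue_row n]_x f (- x)%R.
Proof.
move=> QQ mf f0; pose b (x : 'rV[R]_n) : \bar R := (\1_unit_ball x)%:E.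
have b0 x : 0 <= b x by rewrite lee_fin.
have mb : measurable_fun setT b by exact/measurable_EFinP.
have intb : lebesgue_row n unit_ball = \int[lebesgue_row n]_x b x.
  by rewrite integral_indic// setIT.
have fb0 x y : 0 <= f x * b y by rewrite mule_ge0.
have mQ d (T : measurableType d) (g : T -> 'rV[R]_n) : measurable_fun setT g ->
  measurable_fun setT (fun t => g t *m Q) by exact: measurable_row_mulmx.
have mD d (T : measurableType d) (g h : T -> 'rV[R]_n) :
  measurable_fun setT g -> measurable_fun setT h ->
  measurable_fun setT (fun t => f (g t) * b (h t)).
  by move=> mg mh; apply: emeasurable_funM; [exact: (measurableT_comp mf)|
    exact: (measurableT_comp mb)].
have mN d (T : measurableType d) (g : T -> 'rV[R]_n) :
  measurable_fun setT g -> measurable_fun setT (fun t => - g t)%R.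
  move=> mg; under eq_fun do rewrite -scaleN1r.
  exact: measurable_rowZ.
have mI : measurable_fun setT (fun x : 'rV[R]_n => x) by [].
have mfst : measurable_fun setT (@fst 'rV[R]_n 'rV[R]_n) by exact: measurable_fst.
have msnd : measurable_fun setT (@snd 'rV[R]_n 'rV[R]_n) by exact: measurable_snd.
rewrite -ge0_integralZr//; last by exact: (measurableT_comp mf) (mQ _ _ _ mI).
(* The measure of the ball is written as an integral over [y]; translating [y] by [x *m Q] puts the
   same [x *m Q] into both factors. *)
transitivity (\int[lebesgue_row n]_x \int[lebesgue_row n]_y
    (f (x *m Q) * b (y + x *m Q)%R)).
  apply: eq_integral => x _.
  rewrite intb -(ge0_integralZl _ measurableT mb (fun y _ => b0 y) (f0 _)).
  have mfb : measurable_fun setT (fun y => f (x *m Q) * b y).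
    exact: mD (measurable_cst _) mI.
  by rewrite -[LHS](ge0_integral_row_translate (x *m Q) mfb (fun y => fb0 _ _)).
rewrite (fubini_tonelli (fun p : 'rV[R]_n * 'rV[R]_n => f (p.1 *m Q) * b (p.2 + p.1 *m Q)%R)); last 2 first.
  by apply: mD; [exact: mQ|apply: measurable_rowD => //; exact: mQ].
  by move=> p; exact: fb0.
(* Replacing [x] by [x - y *m Q^T] removes [y] from the ball factor and moves it into [f]. *)
transitivity (\int[lebesgue_row n]_y \int[lebesgue_row n]_x
    (f (x *m Q - y)%R * b (x *m Q))).
  apply: eq_integral => y _.
  have mfb : measurable_fun setT (fun x => f (x *m Q) * b (y + x *m Q)%R).
    by apply: mD; [exact: mQ|apply: measurable_rowD => //; exact: mQ].
  rewrite -[LHS](ge0_integral_row_translate (- (y *m Q^T))%R mfb (fun x => fb0 _ _)).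
  apply: eq_integral => x _.
  by rewrite mulmxDl mulNmx -mulmxA (mulmx1C QQ) mulmx1 [(y + _)%R]addrC subrK.
rewrite (fubini_tonelli (fun p : 'rV[R]_n * 'rV[R]_n => f (p.2 *m Q - p.1)%R * b (p.2 *m Q))); last 2 first.
  by apply: mD; [apply: measurable_rowD; [exact: mQ|exact: mN]|exact: mQ].
  by move=> p; exact: fb0.
rewrite intb -ge0_integralZr//; last first.
  by apply: integral_ge0 => x _; exact: f0.
apply: eq_integral => x _ /=.
have -> : b (x *m Q) = b x.
  have xQE : (x *m Q \in unit_ball) = (x \in unit_ball).
    by apply/idP/idP; rewrite !inE /unit_ball/= enorm_mulmx.
  by rewrite /b !indicE xQE.
under eq_integral do rewrite muleC.
have mfN : measurable_fun setT (fun y : 'rV[R]_n => f (- y)%R).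
  by apply: (measurableT_comp mf); exact: mN.
rewrite ge0_integralZl//; last first.
  by apply: (measurableT_comp mf); apply: measurable_rowD => //; exact: mN.
rewrite -[in RHS](ge0_integral_row_translate (- (x *m Q))%R)//.
by congr (_ * _); apply: eq_integral => y _; rewrite opprD opprK addrC.
Qed.

(** [average] for [Q] and for the identity have the same right-hand side; the measure of the ball
    cancels, being positive and finite. *)
Lemma ge0_integral_row_orthogonal (Q : 'M[R]_n) (f : 'rV[R]_n -> \bar R) :
  Q *m Q^T = 1%:M -> measurable_fun setT f -> (forall x, 0 <= f x) ->
  \int[lebesgue_row n]_x f (x *m Q) = \int[lebesgue_row n]_x f x.
Proof.
move=> QQ mf f0; have := average QQ mf f0.
have Q1 : (1%:M *m (1%:M)^T = 1%:M :> 'M[R]_n)%R by rewrite trmx1 mulmx1.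
rewrite -(average Q1 mf f0).
under [in X in _ = X -> _]eq_integral do rewrite mulmx1.
move: unit_ball_fin unit_ball_gt0.
case: (lebesgue_row n unit_ball) => // r _ r0 /eqP.
by rewrite eq_le !lee_pmul2r// -eq_le => /eqP.
Qed.

End lebesgue_row_orthogonal.

(** * Open sets of rows: measurability and positive measure *)

Section row_topology.
Context {R : realType} {n : nat}.

Lemma nbhs_rowP (x : 'rV[R]_n) (U : set 'rV[R]_n) : nbhs x U ->
  exists2 r : R, 0 < r & forall y : 'rV[R]_n, (forall i, `|y 0 i - x 0 i| < r) -> U y.
Proof.
move=> /nbhs_ballP[r /= r0 xrU]; exists r => // y xy; apply: xrU; split => // i j.
by rewrite (ord1 i) /ball/= distrC.
Qed.

(** The sigma-algebra is the one generated by the coordinates, so [U] is exhausted by the countably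
    many closed cubes with rational center and radius [1 / (m + 1)] that it contains. *)
Lemma measurable_open_row (U : set 'rV[R]_n) : open U -> measurable U.
Proof.
move=> oU; pose box (p : 'rV[rat]_n * nat) : set 'rV[R]_n :=
  [set x | forall i, `|x 0 i - ratr (p.1 0 i)| <= p.2.+1%:R^-1].
pose F k := if unpickle k is Some p then box p else set0.
rewrite (_ : U = \bigcup_(k in [set k | F k `<=` U]) F k).
  apply: bigcup_measurable => k _; rewrite /F; case: unpickle => [p|] //.
  rewrite (_ : box p = \bigcap_(i in [set: 'I_n])
      ((fun x : 'rV[R]_n => x 0 i - ratr (p.1 0 i)) @^-1` [set y | `|y| <= p.2.+1%:R^-1])).
    apply: fin_bigcap_measurable => // i _; rewrite -[X in measurable X]setTI.
    have mf : measurable_fun setT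
      (fun x : 'rV[R]_n => x 0 i - ratr (p.1 0 i) : measurableTypeR R).
      by apply: measurable_funB => //; exact: measurable_coord.
    apply: mf => //; rewrite (_ : mkset _ = `[- p.2.+1%:R^-1, p.2.+1%:R^-1]%classic)//.
    by apply/seteqP; split => y /=; rewrite in_itv/= ler_norml.
  by apply/seteqP; split => x h i => [_|]; apply: h.
apply/seteqP; split => [x Ux|x [k kU]]; last exact: kU.
have [r r0 xrU] := nbhs_rowP (open_nbhs_nbhs (conj oU Ux)).
(* The cube will contain [x] and have radius below [r / 2], so all its points are within [r] of
   [x]. *)
have [m mr] : exists m : nat, m.+1%:R^-1 < r / 2.
  exists (Num.truncn (2 / r)); rewrite -[ltRHS]invrK ltf_pV2 ?posrE ?invr_gt0 ?ltr0n ?divr_gt0//.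
  by rewrite invf_div truncnS_gt.
have /choice[q hq] : forall i, exists q : rat, `|x 0 i - ratr q| <= m.+1%:R^-1.
  move=> i; have [q] := @rat_in_itvoo R (x 0 i - m.+1%:R^-1) (x 0 i + m.+1%:R^-1)
    ltac:(by rewrite ltrD2l gtrN ?invr_gt0 ?ltr0n).
  rewrite in_itv/= => /andP[q1 q2]; exists q.
  move: (m.+1%:R^-1) (ratr q) (x 0 i) q1 q2 => c qi xi q1 q2.
  by rewrite ler_norml; apply/andP; split; lra.
have Fx : F (pickle (\row_i q i, m)) = box (\row_i q i, m) by rewrite /F pickleK.
exists (pickle (\row_i q i, m)); rewrite /mkset Fx.
  move=> y yb; apply: xrU => i; have := yb i; rewrite /= mxE => yq.
  apply: le_lt_trans (ler_distD (ratr (q i)) _ _) _.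
  by rewrite [ltRHS]splitr ltr_leD// ?(le_lt_trans yq)// distrC (le_trans (hq i))// ltW.
by move=> i; rewrite /= mxE.
Qed.

Lemma measurable_closed_row (A : set 'rV[R]_n) : closed A -> measurable A.
Proof.
move=> cA; rewrite -[A]setCK; apply: measurableC; apply: measurable_open_row.
by rewrite openC.
Qed.

Local Open Scope ereal_scope.

(** A translation brings a point of [U] to the origin, where the translated set contains a cube of
    known measure. *)
Lemma lebesgue_row_open_gt0 (U : set 'rV[R]_n) : open U -> U !=set0 ->
  0 < lebesgue_row n U.
Proof.
move=> oU [x Ux]; have [r r0 xrU] := nbhs_rowP (open_nbhs_nbhs (conj oU Ux)).
have r20 : (0 < r / 2)%R by rewrite divr_gt0.
have mU := measurable_open_row oU.
have mUx : measurable ((fun y => y + x)%R @^-1` U).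
  by rewrite -[X in measurable X]setTI; apply: measurable_rowD.
suff -> : lebesgue_row n U = lebesgue_row n ((fun y => y + x)%R @^-1` U).
  apply: (@lt_le_trans _ _ (lebesgue_row n (row_box (r / 2)))).
    by rewrite lebesgue_row_box ?(ltW r20)// lte_fin exprn_gt0// mulr_gt0.
  apply: le_measure; rewrite ?inE//; first exact: measurable_row_box.
  move=> y yr; apply: xrU => i; rewrite mxE addrK (le_lt_trans (yr i))//.
  by rewrite ltr_pdivrMr// ltr_pMr// ltr1n.
have intE A : measurable A -> lebesgue_row n A =
    \int[lebesgue_row n]_y (\1_A y)%:E.
  by move=> mA; rewrite integral_indic// setIT.
rewrite !intE//.
rewrite -[LHS](ge0_integral_row_translate x)//.
by apply/measurable_EFinP.
Qed.

End row_topology.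

(** * Slicing space along an orthonormal frame *)

Section frame.
Context {R : realType} {n : nat}.
Implicit Types (e : 'rV[R]_n.+1) (B : 'M[R]_(n, n.+1)).

Definition frame_mx e B : 'M[R]_n.+1 := col_mx e B.

Lemma row_cons_frame e B t (y : 'rV[R]_n) :
  row_cons (t, y) *m frame_mx e B = t *: e + y *m B.
Proof.
apply/rowP => i; rewrite !mxE big_ord_recl; congr (_ + _).
  rewrite mxE unlift_none; congr (_ * _).
  rewrite -(col_mxEu e B ord0 i) /frame_mx; congr (fun_of_matrix _ _ _).
  exact: ord_inj.
apply: eq_bigr => j _; rewrite mxE liftK; congr (_ * _).
rewrite -(col_mxEd e B j i) /frame_mx; congr (fun_of_matrix _ _ _).
exact: ord_inj.
Qed.

Lemma frame_mx_orthogonal e B : unit_sphere e -> orthonormal_frame e B ->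
  frame_mx e B *m (frame_mx e B)^T = 1%:M.
Proof.
move=> e1 [BB Be]; change (col_mx e B *m (col_mx e B)^T = 1%:M :> 'M[R]_(1 + n)).
rewrite tr_col_mx mul_col_row BB Be.
have -> : e *m e^T = 1%:M.
  by rewrite [LHS]mx11_scalar -/(dot e e) unit_sphere_dot.
have -> : e *m B^T = 0 by rewrite -[LHS]trmxK trmx_mul trmxK Be trmx0.
by rewrite -scalar_mx_block.
Qed.

Lemma dot_frame e B y : orthonormal_frame e B -> dot e (y *m B) = 0.
Proof. by move=> [_ Be]; rewrite dotC /dot -mulmxA Be mulmx0 mxE. Qed.

Local Open Scope ereal_scope.

(** The rows [e] and [B] form an orthogonal matrix, so by invariance the first coordinate may be
    taken as the height along [e]. *)
Lemma ge0_integral_frame e B (f : 'rV[R]_n.+1 -> \bar R) :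
  unit_sphere e -> orthonormal_frame e B ->
  measurable_fun setT f -> (forall x, 0 <= f x) ->
  \int[lebesgue_row n.+1]_x f x =
  \int[@lebesgue_measure R]_t \int[lebesgue_row n]_y f (t *: e + y *m B)%R.
Proof.
move=> e1 eB mf f0.
rewrite -(ge0_integral_row_orthogonal (frame_mx_orthogonal e1 eB))//.
have mfQ : measurable_fun setT (fun x => f (x *m frame_mx e B)).
  by apply: (measurableT_comp mf); exact: measurable_row_mulmx.
rewrite (ge0_integral_rowS mfQ (fun x => f0 _)).
by under eq_integral do under eq_integral do rewrite row_cons_frame.
Qed.

(** In a frame whose first vector is [normalize w], only the slice at height 0 meets the hyperplane,
    and a single height is negligible. *)
Lemma lebesgue_row_hyperplane (w : 'rV[R]_n.+1) : w != 0%R ->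
  lebesgue_row n.+1 (orthogonal_compl w) = 0.
Proof.
move=> w0; have u1 := enorm_normalize w0.
have [B uB] := exists_orthonormal_frame u1.
have mw : measurable (orthogonal_compl w) by exact: measurable_orthogonal_compl.
rewrite -[LHS](congr1 (lebesgue_row n.+1) (setIT _)) -integral_indic//.
rewrite (ge0_integral_frame u1 uB)//; last exact/measurable_EFinP.
rewrite -[RHS](integral_set1 (fun t => \int[lebesgue_row n]_y
  (\1_(orthogonal_compl w) (t *: normalize w + y *m B)%R)%:E) 0%R).
rewrite [RHS]integral_mkcond; apply: eq_integral => t _.
rewrite patchE; case: ifPn => //.
rewrite notin_setE/= => /eqP t0; apply: integral0_eq => y _.
rewrite indicE memNset// => /= => /eqP; rewrite /orthogonal_compl/= dotDr.
have -> : dot w (y *m B) = 0%R.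
  by rewrite [w]scale_normalize dotZl dot_frame// mulr0.
rewrite addr0 dotZr dot_normalize !mulf_eq0 (negbTE t0) invr_eq0.
by rewrite enorm_eq0 -enorm_sqr sqrf_eq0 enorm_eq0 (negbTE w0).
Qed.

End frame.

(** * The spherical measure *)

Section euclidean_continuity.
Context {R : realType} {n : nat} {T : Type} {F : set_system T} {FF : Filter F}.
Implicit Types (f g : T -> 'rV[R]_n) (a b : 'rV[R]_n).

Lemma cvg_dot f g a b : f @ F --> a -> g @ F --> b ->
  dot (f x) (g x) @[x --> F] --> dot a b.
Proof.
move=> fa gb; rewrite dotE; under eq_cvg do rewrite dotE.
apply: cvg_big => [|i _]; first exact: add_continuous.
by apply: cvgM; apply: (cvg_comp _ (fun M : 'rV[R]_n => M 0 i) _);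
   [exact: fa|exact: coord_continuous|exact: gb|exact: coord_continuous].
Qed.

Lemma cvg_enorm f a : f @ F --> a -> enorm (f x) @[x --> F] --> enorm a.
Proof.
move=> fa; apply: (cvg_comp _ Num.sqrt (cvg_dot fa fa)).
exact: sqrt_continuous.
Qed.

Lemma cvg_normalize f a : a != 0 -> f @ F --> a ->
  normalize (f x) @[x --> F] --> normalize a.
Proof.
move=> a0 fa; apply: cvgZ => //; apply: cvgV; first by rewrite enorm_eq0.
exact: cvg_enorm.
Qed.

End euclidean_continuity.

Section euclidean_continuous.
Context {R : realType} {n : nat}.

Lemma continuous_enorm : continuous (@enorm R n).
Proof. by move=> x; apply: (@cvg_enorm _ _ _ (nbhs x) _ id); exact: cvg_id. Qed.

Lemma continuous_normalize (x : 'rV[R]_n) : x != 0 ->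
  {for x, continuous normalize}.
Proof.
move=> x0; apply: (@cvg_normalize _ _ _ (nbhs x) _ id) => //; exact: cvg_id.
Qed.

Lemma continuous_dot (w : 'rV[R]_n) : continuous (dot w).
Proof.
move=> x; apply: (@cvg_dot _ _ _ (nbhs x) _ (fun=> w) id); first exact: cvg_cst.
exact: cvg_id.
Qed.

End euclidean_continuous.

Section spherical_measure_theory.
Context {R : realType} {n : nat}.
Local Open Scope ereal_scope.
Local Notation sigma := (@spherical_measure R n).

Lemma ge0_integral_spherical (f : 'rV[R]_n -> \bar R) :
  measurable_fun setT f -> (forall x, 0 <= f x) ->
  \int[sigma]_x f x = \int[lebesgue_row n]_x
    ((n%:R * \1_punctured_ball x)%:E * f (normalize x)).
Proof.
move=> mf f0; apply: ge0_integral_weighted => //.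
- exact: measurable_normalize.
- apply: measurable_funM => //; apply: measurable_indic.
  exact: measurable_punctured_ball.
move=> A mA; rewrite /spherical_measure.
have mNA : measurable (normalize @^-1` A : set 'rV[R]_n).
  by rewrite -[X in measurable X]setTI; exact: measurable_normalize.
have mpb := @measurable_punctured_ball R n.
rewrite (eq_integral (fun x => n%:R%:E *
    (\1_(normalize @^-1` A `&` punctured_ball) x)%:E)); last first.
  by move=> x _; rewrite -!EFinM indicI/= mulrAC mulrA.
rewrite ge0_integralZl ?integral_indic ?setIT ?lee_fin//=.
- exact: measurableI.
- exact/measurable_EFinP/measurable_indic/measurableI.
Qed.

Lemma ge0_integral_spherical_orthogonal (Q : 'M[R]_n) (f : 'rV[R]_n -> \bar R) :
  Q *m Q^T = 1%:M -> measurable_fun setT f -> (forall x, 0 <= f x) ->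
  \int[sigma]_x f (x *m Q) = \int[sigma]_x f x.
Proof.
move=> QQ mf f0.
have mfQ : measurable_fun setT (fun x => f (x *m Q)).
  by apply: (measurableT_comp mf); exact: measurable_row_mulmx.
rewrite !ge0_integral_spherical//.
have mG : measurable_fun setT (fun x : 'rV[R]_n =>
    (n%:R * \1_punctured_ball x)%:E * f (normalize x)).
  apply: emeasurable_funM; last exact: (measurableT_comp mf measurable_normalize).
  apply/measurable_EFinP; apply: measurable_funM => //; apply: measurable_indic.
  exact: measurable_punctured_ball.
have G0 (x : 'rV[R]_n) : 0 <= (n%:R * \1_punctured_ball x)%:E * f (normalize x).
  by rewrite mule_ge0 ?lee_fin ?mulr_ge0.
rewrite -[RHS](ge0_integral_row_orthogonal QQ mG G0).
apply: eq_integral => x _; rewrite normalize_mulmx//; congr (_%:E * _).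
congr (_ * _)%R; rewrite !indicE.
suff -> : (x \in punctured_ball) = (x *m Q \in punctured_ball) by [].
by apply/idP/idP; rewrite !inE /punctured_ball/= enorm_mulmx.
Qed.

Lemma spherical_measure_lty (A : set 'rV[R]_n) : measurable A -> sigma A < +oo.
Proof.
move=> mA; rewrite /spherical_measure lte_mul_pinfty ?lee_fin//.
have mpb := @measurable_punctured_ball R n.
apply: (@le_lt_trans _ _ (lebesgue_row n (row_box 1%R))); last first.
  by rewrite lebesgue_row_box// ltry.
apply: le_measure; rewrite ?inE//.
- apply: measurableI => //; rewrite -[X in measurable X]setTI.
  exact: measurable_normalize.
- exact: measurable_row_box.
- by move=> x [_ /andP[_ x1]] i; rewrite (le_trans (coord_le_enorm _ _)).
Qed.

Lemma spherical_measure_cone_gt0 (A : set 'rV[R]_n) (x : 'rV[R]_n) :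
  measurable A -> x != 0%R -> nbhs x [set y | A (normalize y)] -> 0 < sigma A.
Proof.
move=> mA x0 xA.
have n0 : (0 < n)%N.
  by case: n x x0 {xA mA A} => // x; rewrite [x]thinmx0 eqxx.
rewrite /spherical_measure mule_gt0 ?lte_fin ?ltr0n//.
have ex0 : (0 < enorm x)%R by rewrite enorm_gt0.
(* [t] brings [x] to norm 1/2, strictly inside the ball, so the part of the cone over [A] in the
   punctured ball contains a neighbourhood of [t *: x]. *)
pose t : R := ((2 * enorm x)^-1)%R.
have t0 : (0 < t)%R by rewrite invr_gt0 mulr_gt0.
pose C : set 'rV[R]_n := normalize @^-1` A `&` [set y | (0 < enorm y < 1)%R].
have xC : nbhs (t *: x)%R C.
  apply: filterI.
    have tcvg : (t^-1 *: y)%R @[y --> (t *: x)%R] --> x.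
      rewrite -[X in _ --> X](_ : t^-1 *: (t *: x) = x)%R.
        exact: scaler_continuous.
      by rewrite scalerA mulVf ?scale1r// gt_eqF.
    have : nbhs (t *: x)%R [set y | A (normalize (t^-1 *: y)%R)] := tcvg _ xA.
    by apply: filterS => y /=; rewrite normalizeZ// invr_gt0.
  have h : open [set r : R | (0 < r < 1)%R].
    rewrite (_ : mkset _ = `]0%R, 1%R[%classic); first exact: interval_open.
    by apply/seteqP; split => r /=; rewrite in_itv.
  have /continuous_enorm// : nbhs (enorm (t *: x)%R) [set r : R | (0 < r < 1)%R].
  apply: open_nbhs_nbhs; split => //=.
  rewrite enormZ (gtr0_norm t0) /t invfM -mulrA mulVf ?mulr1 ?gt_eqF//.
  by rewrite invr_gt0 invf_lt1// ltr0n ltr1n.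
apply: (@lt_le_trans _ _ (lebesgue_row n C^°)).
  apply: lebesgue_row_open_gt0; first exact: open_interior.
  by exists (t *: x)%R.
apply: le_measure; rewrite ?inE.
- by apply: measurable_open_row; exact: open_interior.
- apply: measurableI; last exact: measurable_punctured_ball.
  rewrite -[X in measurable X]setTI; exact: measurable_normalize.
- move=> y /interior_subset [? /andP[y0 y1]]; split => //=.
  by rewrite /punctured_ball/= y0 ltW.
Qed.

End spherical_measure_theory.

Section exprn_integral.
Context {R : realType}.

Lemma integral_exprn (m : nat) (r : R) : 0 < r ->
  (\int[lebesgue_measure]_(x in `[0%R, r]) (m.+1%:R * x ^+ m)%:E = (r ^+ m.+1)%:E)%E.
Proof.
move=> r0; rewrite (continuous_FTC2 (F := fun x : R => x ^+ m.+1))//.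
- by rewrite expr0n/= sube0.
- apply/continuous_subspaceT => x.
  by apply: cvgM; [exact: cvg_cst|exact: exprn_continuous].
- split.
  + by move=> x _; exact: exprn_derivable.
  + exact/cvg_at_right_filter/exprn_continuous.
  + exact/cvg_at_left_filter/exprn_continuous.
- by move=> x _; rewrite exp_derive1.
Qed.

End exprn_integral.

(** * The gnomonic change of variables *)

Section gnomonic_integral.
Context {R : realType} {n : nat}.
Variables (e : 'rV[R]_n.+1) (B : 'M[R]_(n, n.+1)).
Hypotheses (e1 : unit_sphere e) (eB : orthonormal_frame e B).
Local Open Scope ereal_scope.
Local Notation sigma := (@spherical_measure R n.+1).

(** A point of the affine hyperplane tangent to the sphere at [e]; normalizing it inverts the
    gnomonic projection. *)
Let lift (y : 'rV[R]_n) : 'rV[R]_n.+1 := (e + y *m B)%R.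

Let dot_lift y : dot e (lift y) = 1%R.
Proof. by rewrite /lift dotDr unit_sphere_dot// dot_frame// addr0. Qed.

Let lift_neq0 y : lift y != 0%R.
Proof.
apply/eqP => y0; have := dot_lift y; rewrite y0 dot0r => /eqP.
by rewrite eq_sym oner_eq0.
Qed.

Let measurable_lift : measurable_fun setT lift.
Proof. by apply: measurable_rowD => //; exact: measurable_row_mulmx. Qed.

Let cone : set (measurableTypeR R * 'rV[R]_n) :=
  [set p | (0 < p.1)%R /\ (p.1 * enorm (lift p.2) <= 1)%R].

Let measurable_cone : measurable cone.
Proof.
rewrite (_ : cone = (fst @^-1` `]0%R, +oo[%classic) `&`
  ((fun p => p.1 * enorm (lift p.2))%R @^-1` `]-oo, 1%R]%classic)).
  apply: measurableI; rewrite -[X in measurable X]setTI.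
    exact: measurable_fst.
  suff mf : measurable_fun setT (fun p : measurableTypeR R * 'rV[R]_n =>
      (p.1 * enorm (lift p.2))%R : measurableTypeR R) by exact: mf.
  apply: measurable_funM; first exact: measurable_fst.
  apply: (measurableT_comp measurable_enorm).
  by apply: (measurableT_comp measurable_lift); exact: measurable_snd.
by apply/seteqP; split => -[t y] /=; rewrite !in_itv/= andbT.
Qed.

(** The radial factor of the change of variables: the primitive [t ^ (n + 1)] evaluated at the
    largest admissible [t], which is [1 / r]. *)
Let radial (r : R) : (0 < r)%R ->
  \int[lebesgue_measure]_t
    (n.+1%:R * t ^+ n * \1_[set t | (0 < t)%R /\ (t * r <= 1)%R] t)%:E =
  (r ^- n.+1)%:E.
Proof.
move=> r0; rewrite -exprVn -integral_exprn ?invr_gt0//.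
rewrite -integral_itv_obnd_cbnd; last first.
  apply/measurable_EFinP/measurable_funTS; apply: measurable_funM => //.
rewrite [RHS]integral_mkcond; apply: eq_integral => t _.
rewrite patchE indicE.
have -> : (t \in [set t : R | (0 < t)%R /\ (t * r <= 1)%R]) =
          (t \in `]0%R, (r^-1)%R]%classic).
  apply/idP/idP; rewrite !inE/= in_itv/= -[(r^-1)%R]div1r ler_pdivlMr//.
    by case=> -> ->.
  by case/andP.
by case: ifPn => _; rewrite ?mulr1 ?mulr0.
Qed.

(** [F (normalize x)] is constant along rays. Rescaling the slice at height [t] by [t] produces
    [t ^ n], and integrating over [t] at fixed [y] leaves the Jacobian of the inverse projection. *)
Lemma ge0_integral_spherical_gnomonic (F : 'rV[R]_n.+1 -> \bar R) :
  measurable_fun setT F -> (forall x, 0 <= F x) ->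
  (forall x, (dot e x <= 0)%R -> F x = 0) ->
  \int[sigma]_x F x = \int[lebesgue_row n]_y
    ((enorm (e + y *m B) ^- n.+1)%:E * F (normalize (e + y *m B))).
Proof.
move=> mF F0 Fneg.
have mFn : measurable_fun setT (fun x => F (normalize x)).
  exact: (measurableT_comp mF measurable_normalize).
have mG : measurable_fun setT (fun x : 'rV[R]_n.+1 =>
    (n.+1%:R * \1_punctured_ball x)%:E * F (normalize x)).
  apply: emeasurable_funM => //; apply/measurable_EFinP.
  apply: measurable_funM => //; apply: measurable_indic.
  exact: measurable_punctured_ball.
have G0 (x : 'rV[R]_n.+1) : 0 <= (n.+1%:R * \1_punctured_ball x)%:E * F (normalize x).
  by rewrite mule_ge0 ?lee_fin ?mulr_ge0.
rewrite ge0_integral_spherical// (ge0_integral_frame e1 eB)//.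
pose H (p : measurableTypeR R * 'rV[R]_n) :=
  (n.+1%:R * p.1 ^+ n * \1_cone p)%:E * F (normalize (lift p.2)).
have mFl : measurable_fun setT (fun y => F (normalize (lift y))).
  exact: (measurableT_comp mFn measurable_lift).
have mH : measurable_fun setT H.
  apply: emeasurable_funM; last by apply: (measurableT_comp mFl); exact: measurable_snd.
  apply/measurable_EFinP; apply: measurable_funM; last exact: measurable_indic.
  apply: measurable_funM => //; apply: measurable_funX; exact: measurable_fst.
have H0 p : 0 <= H p.
  rewrite /H indicE; case: (boolP (p \in cone)) => [|_]; last by rewrite mulr0 mul0e.
  rewrite inE => -[p0 _]; rewrite mule_ge0// lee_fin !mulr_ge0//.
  by rewrite exprn_ge0// ltW.
transitivity (\int[lebesgue_measure]_t \int[lebesgue_row n]_y H (t, y)).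
  (* Heights [t <= 0] contribute to neither side: [F] vanishes there, and [cone] excludes them. *)
  apply: eq_integral => t _; have [t0|t0] := leP t 0%R.
    rewrite !integral0_eq// => y _.
      rewrite /H indicE memNset ?mulr0 ?mul0e//= => -[]/=.
      by rewrite ltNge t0.
    rewrite Fneg ?mule0// dot_normalize mulr_ge0_le0 ?invr_ge0 ?enorm_ge0//.
    by rewrite dotDr dotZr unit_sphere_dot// dot_frame// mulr1 addr0.
  have mGt : measurable_fun setT (fun y : 'rV[R]_n => (n.+1%:R *
      \1_punctured_ball (t *: e + y *m B)%R)%:E * F (normalize (t *: e + y *m B)%R)).
    apply: (measurableT_comp mG); apply: measurable_rowD => //.
    exact: measurable_row_mulmx.
  (* The slice is parametrized by [t (e + y)], so that [normalize] no longer depends on [t]. *)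
  rewrite (ge0_integral_row_affine 0%R t0)// -ge0_integralZl//; last 2 first.
  - apply: (measurableT_comp mGt); apply: measurable_rowD => //.
    exact: measurable_rowZ.
  - by rewrite lee_fin exprn_ge0// ltW.
  apply: eq_integral => y _.
  have -> : (t *: e + (t *: y + 0) *m B)%R = (t *: lift y)%R.
    by rewrite addr0 -scalemxAl -scalerDr.
  rewrite normalizeZ// muleA -EFinM mulrCA mulrA; congr (_%:E * _).
  congr (_ * _)%R; rewrite !indicE; congr ((nat_of_bool _)%:R)%R.
  apply/idP/idP; rewrite !inE /punctured_ball /cone/= enormZ gtr0_norm//.
    by move=> /andP[].
  by move=> [_ ->]; rewrite mulr_gt0// enorm_gt0.
rewrite (fubini_tonelli H)//; apply: eq_integral => y _.
rewrite /H/= ge0_integralZr//; last 2 first.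
- apply/measurable_EFinP; apply: measurable_funM.
    by apply: measurable_funM => //; exact: measurable_funX.
  apply: (measurableT_comp (measurable_indic measurable_cone)).
  by apply: measurable_fun_pair => //; exact: measurable_cst.
- move=> t _; rewrite indicE; case: (boolP (_ \in cone)) => [|_]; last by rewrite mulr0.
  by rewrite inE => -[/= t0 _]; rewrite lee_fin !mulr_ge0// exprn_ge0// ltW.
congr (_ * _); rewrite -radial; last by rewrite enorm_gt0; exact: lift_neq0.
apply: eq_integral => t _.
rewrite !indicE.
suff -> : ((t, y) \in cone) = (t \in [set t | (0 < t)%R /\
  (t * enorm (e + y *m B) <= 1)%R]) by [].
by apply/idP/idP; rewrite !inE.
Qed.

End gnomonic_integral.

Lemma nbhs_gt0 (R : realType) (T : topologicalType) (f : T -> R) (x : T) :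
  {for x, continuous f} -> 0 < f x -> nbhs x [set y | 0 < f y].
Proof.
move=> fx fx0; have /fx// : nbhs (f x) [set y : R | 0 < y].
by apply: open_nbhs_nbhs; split => //; exact: open_gt.
Qed.

(** * Relative interiors in the sphere *)

Section relative_interior_sphere.
Context {R : realType} {n : nat}.
Implicit Types (A : set 'rV[R]_n) (x d e : 'rV[R]_n).

(** Since [normalize] is continuous at [x] and fixes the sphere, relative neighbourhoods can be
    extended radially to neighbourhoods in the ambient space. *)
Lemma rel_interior_sphereP A x : unit_sphere x ->
  rel_interior unit_sphere A x <-> nbhs x [set y | A (normalize y)].
Proof.
move=> x1; have x0 := unit_sphere_neq0 x1.
split=> [[_ xA]|xA].
  have nx : normalize y @[y --> x] --> x.
    rewrite -[X in _ --> X](normalize_unit x1); exact: continuous_normalize.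
  have y0 : nbhs x [set y : 'rV[R]_n | y != 0].
    have := nbhs_gt0 (@continuous_enorm R n x); rewrite enorm_gt0 => /(_ x0).
    by apply: filterS => y /=; rewrite enorm_gt0.
  have nxA : nbhs x [set y | unit_sphere (normalize y) -> A (normalize y)].
    exact: nx _ xA.
  apply: filterS2 y0 nxA => y /= yn0; apply.
  exact: enorm_normalize.
by split=> //; rewrite /within/=; apply: filterS xA => y /= yA y1; rewrite -(normalize_unit y1).
Qed.

(** An interior point can be pushed a little in any direction, tangent or not. This is how points
    where an inequality is tight are shown not to be interior. *)
Lemma rel_interior_sphere_path A x d : rel_interior unit_sphere A x ->
  exists2 t : R, 0 < t & A (normalize (x + t *: d)).
Proof.
move=> xA; have x1 : unit_sphere x by case: xA.
move/(rel_interior_sphereP _ x1) : xA => xA.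
have : (x + t *: d) @[t --> (0 : R)] --> x.
  rewrite -[X in _ --> X]addr0 -[X in x + X](scale0r d).
  by apply: cvgD; [exact: cvg_cst|apply: cvgZr_tmp; exact: cvg_id].
move=> /(_ _ xA) /nbhs_ballP[r /= r0 h]; exists (r / 2); first by rewrite divr_gt0.
apply: h; rewrite /ball/= sub0r normrN gtr0_norm ?divr_gt0//.
by rewrite ltr_pdivrMr// ltr_pMr// ltr1n.
Qed.

Lemma open_hemisphereE e : unit_sphere e ->
  open_hemisphere e = [set x | unit_sphere x /\ 0 < dot e x].
Proof.
move=> e1; apply/seteqP; split => x /=.
  move=> xe; have x1 : unit_sphere x by case: xe.
  split=> //; have [t t0 [_]] := rel_interior_sphere_path (- e) xe.
  rewrite dot_normalize dotDr dotZr dotNr unit_sphere_dot// mulrN1 => h.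
  (* [normalize 0] is [0], so [h] carries no information here; but then [x] is a positive multiple
     of [e]. *)
  have [xt|xt] := eqVneq (x + t *: - e) 0.
    move/eqP : xt; rewrite scalerN subr_eq0 => /eqP ->.
    by rewrite dotZr unit_sphere_dot// mulr1.
  by move: h; rewrite pmulr_rge0 ?invr_gt0 ?enorm_gt0// subr_ge0; exact: lt_le_trans.
move=> [x1 ex]; split=> //; rewrite /within/=.
have := nbhs_gt0 (@continuous_dot R n e x) ex.
by apply: filterS => y /= ey y1; split => //; exact: ltW.
Qed.

End relative_interior_sphere.

(** * The measure [tau_hat] in gnomonic coordinates *)

Section tau_hat_theory.
Context {R : realType} {n : nat}.
Implicit Types (e : 'rV[R]_n.+1) (B : 'M[R]_(n, n.+1)).
Local Open Scope ereal_scope.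

Lemma ge0_integral_tau_hat B (f : 'rV[R]_n.+1 -> \bar R) :
  measurable_fun setT f -> (forall x, 0 <= f x) ->
  \int[tau_hat B]_x f x =
  \int[lebesgue_row n]_y ((tau_density (y *m B))%:E * f (y *m B)).
Proof.
move=> mf f0.
have mB := @measurable_mulmx_row R n B.
have md : measurable_fun setT (fun y : 'rV[R]_n => tau_density (y *m B)).
  exact: (measurableT_comp (@measurable_tau_density R n) mB).
apply: ge0_integral_weighted => // [y|A mA]; first exact: powR_ge0.
rewrite /tau_hat [LHS](@ge0_integral_pushforward _ _ _ _ _ _ mB (lebesgue_row n))//.
- rewrite integral_mkcond; apply: eq_integral => y _.
  rewrite patchE indicE.
  have -> : (y \in (fun x : 'rV[R]_n => x *m B) @^-1` A) = (y *m B \in A).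
    by apply/idP/idP; rewrite !inE.
  by case: ifPn => _; rewrite ?mule1 ?mule0.
- apply: (measurable_funS measurableT) => //; apply/measurable_EFinP.
  exact: measurable_tau_density.
- by move=> y _; rewrite lee_fin powR_ge0.
Qed.

(** By Pythagoras [1 + |y|^2 = |e + y|^2], which makes the density comparable with the Jacobian of
    the projection. *)
Lemma tau_densityE e B (y : 'rV[R]_n) : unit_sphere e -> orthonormal_frame e B ->
  tau_density (y *m B) = (enorm (e + y *m B) ^- n.+2)%R.
Proof.
move=> e1 eB; rewrite /tau_density; set r := enorm (e + y *m B).
have -> : (1 + enorm (y *m B) ^+ 2 = r ^+ 2)%R.
  rewrite /r !enorm_sqr dotDl !dotDr (unit_sphere_dot e1) (dotC _ e) !(dot_frame _ eB).
  by rewrite addr0 add0r.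
have r0 : (0 <= r)%R by exact: enorm_ge0.
rewrite -powR_mulrn// -powRrM mulrN mulrCA divff// mulr1.
by rewrite powRN powR_mulrn.
Qed.

(** The image is described through the inverse map [x |-> normalize (e + x)], which turns its
    measurability into that of a preimage. *)
Lemma gnomonic_imageE e (A : set 'rV[R]_n.+1) : unit_sphere e ->
  A `<=` unit_sphere -> (forall x, A x -> (0 < dot e x)%R) ->
  gnomonic e @` A = [set x | dot e x = 0%R /\ A (normalize (e + x))].
Proof.
move=> e1 A1 Ae; apply/seteqP; split => [_ [v Av <-]|x /= [ex Ax]].
  have ev := Ae _ Av; rewrite /gnomonic /= dotDr dotZr dotNr unit_sphere_dot//.
  rewrite mulVf ?gt_eqF// subrr; split=> //.
  by rewrite addrC subrK normalizeZ ?invr_gt0// normalize_unit//; exact: A1.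
exists (normalize (e + x)) => //; rewrite /gnomonic dot_normalize dotDr.
rewrite unit_sphere_dot// ex addr0 mulr1 invrK -scale_normalize addrC.
by rewrite addKr.
Qed.

Lemma measurable_gnomonic_image e (A : set 'rV[R]_n.+1) : unit_sphere e ->
  A `<=` unit_sphere -> (forall x, A x -> (0 < dot e x)%R) -> measurable A ->
  measurable (gnomonic e @` A).
Proof.
move=> e1 A1 Ae mA; rewrite gnomonic_imageE//.
rewrite (_ : mkset _ = orthogonal_compl e `&` (fun x => normalize (e + x)%R) @^-1` A)//.
apply: measurableI; first exact: measurable_orthogonal_compl.
rewrite -[X in measurable X]setTI.
apply: (measurableT_comp (@measurable_normalize R n.+1)) => //.
exact: measurable_rowD.
Qed.

(** Homogeneity gives [f (normalize (e + y)) = f (e + y) / |e + y|]; this power and the [n + 1]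
    powers of the Jacobian make up the exponent [n + 2] of the density. *)
Lemma integral_gnomonic e B (A : set 'rV[R]_n.+1) (f : 'rV[R]_n.+1 -> R) :
  unit_sphere e -> orthonormal_frame e B -> measurable A -> A `<=` unit_sphere ->
  (forall x, A x -> (0 < dot e x)%R) ->
  measurable_fun setT f -> (forall x, (0 <= f x)%R) ->
  (forall t x, (0 < t)%R -> f (t *: x)%R = (t * f x)%R) ->
  \int[tau_hat B]_(x in gnomonic e @` A) (f (e + x)%R)%:E =
  \int[@spherical_measure R n.+1]_(x in A) (f x)%:E.
Proof.
move=> e1 eB mA A1 Ae mf f0 fZ; have := measurable_gnomonic_image e1 A1 Ae mA.
rewrite gnomonic_imageE//; set M := mkset _ => mM.
rewrite integral_mkcond [RHS]integral_mkcond.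
have mfA : measurable_fun setT ((fun x => (f x)%:E) \_ A).
  apply/(measurable_restrictT _ _).1 => //.
  by apply: (measurable_funS measurableT) => //; exact/measurable_EFinP.
have mfM : measurable_fun setT ((fun x => (f (e + x)%R)%:E) \_ M).
  apply/(measurable_restrictT _ _).1 => //.
  apply: (measurable_funS measurableT) => //; apply/measurable_EFinP.
  by apply: (measurableT_comp mf); apply: measurable_rowD.
rewrite ge0_integral_tau_hat//; last first.
  by move=> x; rewrite erestrict_ge0// => ? _; rewrite lee_fin.
rewrite (ge0_integral_spherical_gnomonic e1 eB)//; last 2 first.
- by move=> x; rewrite erestrict_ge0// => ? _; rewrite lee_fin.
- move=> x ex; rewrite patchE ifF//; apply/negP; rewrite inE => /Ae.
  by rewrite ltNge ex.
apply: eq_integral => y _; rewrite !patchE (tau_densityE _ e1 eB).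
have -> : (y *m B \in M) = (normalize (e + y *m B) \in A).
  by apply/idP/idP; rewrite !inE /M/= (dot_frame _ eB) => // -[].
case: ifPn => _; last by rewrite !mule0.
have z0 : (0 < enorm (e + y *m B)%R)%R.
  rewrite enorm_gt0; apply/eqP => z0.
  have := dotDr e e (y *m B); rewrite z0 dot0r unit_sphere_dot// dot_frame//.
  by rewrite addr0 => /eqP; rewrite eq_sym oner_eq0.
rewrite /normalize fZ ?invr_gt0// -!EFinM mulrA; congr (_ * _)%:E.
by rewrite -invfM -exprSr.
Qed.

End tau_hat_theory.

(** * Moments of a symmetric convex body *)

Section reflection.
Context {R : realType} {n : nat}.
Implicit Types (e u v w x : 'rV[R]_n).

(** For a unit vector [e], this is [2 P - 1] with [P] the projection onto the line of [e]. The
    matrix form gives access to orthogonal invariance. *)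
Definition reflection_mx e : 'M[R]_n := 2 *: (e^T *m e) - 1%:M.

Lemma sph_reflectionE e v : sph_reflection e v = v *m reflection_mx e.
Proof.
rewrite /sph_reflection /reflection_mx mulmxBr mulmx1 -scalemxAr mulmxA addrC.
congr (_ - _); rewrite -scalerA; congr (_ *: _).
by rewrite [v *m e^T]mx11_scalar mul_scalar_mx.
Qed.

Lemma dot_sph_reflection e w v :
  dot w (sph_reflection e v) = - dot w v + 2 * dot v e * dot w e.
Proof. by rewrite dotDr dotNr dotZr. Qed.

Lemma reflection_mx_orthogonal e : unit_sphere e ->
  reflection_mx e *m (reflection_mx e)^T = 1%:M.
Proof.
move=> e1; have ee : e *m e^T = 1%:M.
  by rewrite [LHS]mx11_scalar -/(dot e e) unit_sphere_dot.
have -> : (reflection_mx e)^T = reflection_mx e.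
  by rewrite /reflection_mx linearB/= linearZ/= trmx_mul trmxK trmx1.
have PP : (e^T *m e) *m (e^T *m e) = e^T *m e.
  by rewrite mulmxA -(mulmxA e^T) ee mulmx1.
rewrite /reflection_mx; move: (e^T *m e) PP => P PP.
rewrite mulmxBr mulmx1 -scalemxAr mulmxBl mul1mx -scalemxAl PP.
by apply/matrixP => i j; rewrite !mxE; ring.
Qed.

Lemma sph_reflectionK e : unit_sphere e -> involutive (sph_reflection e).
Proof.
move=> e1 v; rewrite /sph_reflection dotDl dotNl dotZl unit_sphere_dot// mulr1.
by apply/rowP => i; rewrite !mxE; ring.
Qed.

End reflection.

Section integrable_sphere.
Context {R : realType} {n : nat}.
Local Notation sigma := (@spherical_measure R n).

Lemma bounded_integrable_spherical (A : set 'rV[R]_n) (f : 'rV[R]_n -> R) (M : R) :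
  measurable A -> measurable_fun setT f -> (forall x, A x -> `|f x| <= M) ->
  sigma.-integrable A (EFin \o f).
Proof.
move=> mA mf fM; apply: measurable_bounded_integrable => //.
- exact: spherical_measure_lty.
- exact: measurable_funS mf.
- exists M; split; first by rewrite num_real.
  by move=> r Mr x /fM /le_trans; apply; exact: ltW.
Qed.

(** Normalizing only rescales [dot w x], so the cone over this great subsphere lies in the null
    hyperplane. *)
Lemma spherical_measure_hyperplane0 (w : 'rV[R]_n) : w != 0 ->
  sigma (orthogonal_compl w) = 0%E.
Proof.
case: n w => [|m] w w0; first by move: w0; rewrite [w]thinmx0 eqxx.
apply/eqP; rewrite eq_le measure_ge0 andbT /spherical_measure.
rewrite (_ : _ (_ `&` _) = 0%E) ?mule0//.
have mw : measurable (orthogonal_compl w) by exact: measurable_orthogonal_compl.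
apply: (subset_measure0 (mu := lebesgue_row m.+1) (B := orthogonal_compl w)) => //.
- apply: measurableI; last exact: measurable_punctured_ball.
  by rewrite -[X in measurable X]setTI; exact: measurable_normalize.
- move=> x [+ /andP[x0 _]]; rewrite /= /orthogonal_compl/= dot_normalize.
  by move=> /eqP; rewrite mulf_eq0 invr_eq0 (gt_eqF x0) => /eqP.
- exact: lebesgue_row_hyperplane.
Qed.

End integrable_sphere.

Section symmetric_halves.
Context {R : realType} {n : nat}.
Variables (e : 'rV[R]_n) (K : set 'rV[R]_n).
Hypotheses (e1 : unit_sphere e) (K1 : K `<=` unit_sphere) (mK : measurable K).
Hypothesis K_refl : forall x, K x -> K (sph_reflection e x).
Local Notation sigma := (@spherical_measure R n).

Lemma measurable_half u : measurable (K `&` hemisphere u).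
Proof.
rewrite (_ : K `&` hemisphere u = K `&` dot u @^-1` `[0, +oo[%classic).
  apply: measurableI => //; rewrite -[X in measurable X]setTI.
  exact: (@measurable_dot _ _ _ _ u (fun x => x)).
apply/seteqP; split => x [Kx] /=; first by move=> [_ ux]; rewrite in_itv/= ux.
by rewrite in_itv/= andbT => ux; split => //; split => //; exact: K1.
Qed.

(** As [u] is orthogonal to [e], the reflection negates [dot u]; it thus exchanges the two halves of
    [K] and preserves both [g] and the measure. *)
Lemma half_integral u (g : 'rV[R]_n -> R) (M : R) :
  u != 0 -> dot e u = 0 -> measurable_fun setT g -> (forall x, 0 <= g x) ->
  (forall x, g (sph_reflection e x) = g x) -> (forall x, K x -> g x <= M) ->
  \int[sigma]_(x in K) g x = 2 * \int[sigma]_(x in K `&` hemisphere u) g x.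
Proof.
move=> u0 eu mg g0 g_refl gM.
have gi A : measurable A -> A `<=` K -> sigma.-integrable A (EFin \o g).
  move=> mA AK; apply: (@bounded_integrable_spherical _ _ _ _ M) => // x /AK Kx.
  by rewrite ger0_norm// gM.
have mKu := measurable_half u.
have mKDu : measurable (K `\` hemisphere u).
  have -> : K `\` hemisphere u = K `\` (K `&` hemisphere u).
    by rewrite setDIr setDv set0U.
  exact: measurableD.
have {1}-> : K = (K `&` hemisphere u) `|` (K `\` hemisphere u).
  by rewrite setUIDK.
rewrite Rintegral_setU//; last 2 first.
- by rewrite setUIDK; exact: gi.
- by apply/disj_setPS => x [[_ ux] [_ nux]].
rewrite mulr_natl mulr2n; congr (_ + _); congr fine.
(* [D] is the exact mirror image of the half in [hemisphere u]; it exceeds the set difference only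
   by points with [dot u x = 0], a null set. *)
pose D := [set x | K x /\ dot u x <= 0].
have mD : measurable D.
  rewrite (_ : D = K `&` dot u @^-1` `]-oo, 0]%classic).
    apply: measurableI => //; rewrite -[X in measurable X]setTI.
    exact: (@measurable_dot _ _ _ _ u (fun x => x)).
  by apply/seteqP; split => x [Kx] /=; rewrite in_itv/=.
have mu0 : measurable (orthogonal_compl u) by exact: measurable_orthogonal_compl.
have mgE : measurable_fun setT (EFin \o g) by exact/measurable_EFinP.
transitivity (\int[sigma]_(x in D) (g x)%:E)%E.
  rewrite [RHS](@ge0_negligible_integral _ _ _ _ _ (orthogonal_compl u))//; first last.
  - exact: spherical_measure_hyperplane0.
  - by move=> x _; rewrite lee_fin.
  - exact: measurable_funS mgE.
  congr (integral _ _ _); apply/seteqP; split => x.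
    move=> [Kx nux]; have ux : dot u x < 0.
      by rewrite ltNge; apply/negP => ux; apply: nux; split => //; exact: K1.
    by split; [split => //; exact: ltW|rewrite /orthogonal_compl/=; apply/eqP; rewrite lt_eqF].
  move=> [[Kx ux] nux]; split=> // -[_ ux']; apply: nux; rewrite /orthogonal_compl/=.
  by apply/eqP; rewrite eq_le ux ux'.
rewrite [LHS]integral_mkcond [RHS]integral_mkcond.
rewrite -[RHS](ge0_integral_spherical_orthogonal (reflection_mx_orthogonal e1)); last 2 first.
- exact: (iffLR (measurable_restrictT (EFin \o g) mKu) (measurable_funS _ _ mgE)).
- by move=> x; rewrite erestrict_ge0// => ? _; rewrite lee_fin.
apply: eq_integral => x _; rewrite -sph_reflectionE !patchE g_refl.
suff -> : (sph_reflection e x \in K `&` hemisphere u) = (x \in D) by [].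
apply/idP/idP; rewrite !inE.
  move=> [Kx [_]]; rewrite dot_sph_reflection (dotC u e) eu mulr0 addr0 oppr_ge0.
  by split => //; rewrite -(sph_reflectionK e1 x); exact: K_refl.
move=> [Kx ux]; split; first exact: K_refl.
split; first by apply: K1; exact: K_refl.
by rewrite dot_sph_reflection (dotC u e) eu mulr0 addr0 oppr_ge0.
Qed.

End symmetric_halves.

Section moments.
Context {R : realType} {n : nat}.
Local Notation sigma := (@spherical_measure R n).

(** For [w] orthogonal to [e], the quotient by [width K e] will be the support function of the
    [tau_hat]-centroid body; [width K e] is the [tau_hat]-mass of the gnomonic image. *)
Definition width (K : set 'rV[R]_n) (w : 'rV[R]_n) : R :=
  \int[sigma]_(x in K) `|dot w x|.

Definition half_moment (K : set 'rV[R]_n) (u : 'rV[R]_n) : 'rV[R]_n :=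
  \row_i \int[sigma]_(x in K `&` hemisphere u) x 0 i.

Lemma measurable_dot_id (w : 'rV[R]_n) : measurable_fun setT (dot w).
Proof. exact: (@measurable_dot _ _ _ _ w (fun x => x)). Qed.

Lemma measurable_norm_dot (w : 'rV[R]_n) :
  measurable_fun setT (fun x : 'rV[R]_n => `|dot w x|).
Proof. by apply: measurableT_comp => //; exact: measurable_dot_id. Qed.

Lemma dot_unit_le (w x : 'rV[R]_n) : unit_sphere x -> `|dot w x| <= enorm w.
Proof.
by rewrite /unit_sphere/= => x1; rewrite (le_trans (cauchy_schwarz _ _))// x1 mulr1.
Qed.

Section basic.
Variable A : set 'rV[R]_n.
Hypotheses (A1 : A `<=` unit_sphere) (mA : measurable A).

Lemma integrable_dot w : sigma.-integrable A (EFin \o dot w).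
Proof.
apply: (@bounded_integrable_spherical _ _ _ _ (enorm w)) => //.
  exact: measurable_dot_id.
by move=> x /A1; exact: dot_unit_le.
Qed.

Lemma integrable_norm_dot w : sigma.-integrable A (EFin \o (fun x => `|dot w x|)).
Proof.
apply: (@bounded_integrable_spherical _ _ _ _ (enorm w)) => //.
  exact: measurable_norm_dot.
by move=> x /A1; rewrite normr_id; exact: dot_unit_le.
Qed.

Lemma dot_Rintegral w :
  dot w (\row_i \int[sigma]_(x in A) x 0 i) = \int[sigma]_(x in A) dot w x.
Proof.
rewrite dotE; under [RHS]eq_Rintegral do rewrite dotE.
have mcoord s : measurable_fun setT (fun x : 'rV[R]_n => \sum_(i <- s) w 0 i * x 0 i).
  by apply: measurable_sum => i; apply: measurable_funM => //; exact: measurable_coord.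
have coord1 i x : A x -> `|x 0 i| <= 1.
  by move=> /A1 <-; exact: coord_le_enorm.
elim: (index_enum _) => [|i s IH].
  by rewrite big_nil; under eq_Rintegral do rewrite big_nil; rewrite Rintegral_cst// mul0r.
rewrite big_cons mxE; under [RHS]eq_Rintegral do rewrite big_cons.
rewrite RintegralD//.
- rewrite IH; congr (_ + _); rewrite RintegralZl//.
  apply: (@bounded_integrable_spherical _ _ _ _ 1) => // [|x Ax].
    exact: measurable_coord.
  exact: coord1.
- apply: (@bounded_integrable_spherical _ _ _ _ `|w 0 i|) => //.
    by apply: measurable_funM => //; exact: measurable_coord.
  by move=> x Ax; rewrite normrM ler_piMr// coord1.
- apply: (@bounded_integrable_spherical _ _ _ _ (\sum_(i <- s) `|w 0 i|)) => //.
  move=> x Ax; rewrite (le_trans (ler_norm_sum _ _ _))//.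
  by apply: ler_sum => j _; rewrite normrM ler_piMr// coord1.
Qed.

End basic.

Section symmetric.
Variables (e : 'rV[R]_n) (K : set 'rV[R]_n).
Hypotheses (e1 : unit_sphere e) (K1 : K `<=` unit_sphere) (cK : closed K).
Hypothesis K_refl : forall x, K x -> K (sph_reflection e x).
Hypothesis K_ge0 : forall x, K x -> 0 <= dot e x.

Let mK : measurable K. Proof. exact: measurable_closed_row. Qed.
Let mKu u : measurable (K `&` hemisphere u). Proof. exact: measurable_half. Qed.
Let Ku1 u : K `&` hemisphere u `<=` unit_sphere. Proof. by move=> x [/K1]. Qed.

Lemma dot_half_moment w u :
  dot w (half_moment K u) = \int[sigma]_(x in K `&` hemisphere u) dot w x.
Proof. by rewrite /half_moment dot_Rintegral. Qed.

Lemma widthN w : width K (- w) = width K w.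
Proof. by apply: eq_Rintegral => x _; rewrite dotNl normrN. Qed.

Lemma widthZ t w : width K (t *: w) = `|t| * width K w.
Proof.
rewrite /width -RintegralZl//; last exact: integrable_norm_dot.
by apply: eq_Rintegral => x _; rewrite dotZl normrM.
Qed.

Lemma width_ge0 w : 0 <= width K w.
Proof. exact: Rintegral_ge0. Qed.

Lemma width_lipschitz w w' :
  `|width K w - width K w'| <= enorm (w - w') * fine (sigma K).
Proof.
rewrite /width -RintegralB//; try exact: integrable_norm_dot.
have diff_le x : K x -> `| `|dot w x| - `|dot w' x| | <= enorm (w - w').
  move=> /K1 x1; rewrite (le_trans (ler_dist_dist _ _))//.
  by rewrite -dotNl -dotDl dot_unit_le.
have mdiff : measurable_fun setT (fun x => `|dot w x| - `|dot w' x|).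
  by apply: measurable_funB; exact: measurable_norm_dot.
have iB := bounded_integrable_spherical mK mdiff diff_le.
rewrite (le_trans (le_normr_Rintegral mK iB))// -Rintegral_cst//.
apply: le_Rintegral => //.
- apply: (@bounded_integrable_spherical _ _ _ _ (enorm (w - w'))) => //.
    exact: measurableT_comp.
  by move=> x Kx; rewrite normr_id diff_le.
- apply: (@bounded_integrable_spherical _ _ _ _ (enorm (w - w'))) => // x _ /=.
  by rewrite ger0_norm// enorm_ge0.
Qed.

(** The reflection negates [dot w] if [w] is orthogonal to [e] and preserves it if [w = e]; in both
    cases [|dot w x|] is invariant. The two cases feed the two sides of the cone inequality. *)
Lemma half_width w u : u != 0 -> dot e u = 0 -> (dot e w = 0 \/ w = e) ->
  \int[sigma]_(x in K `&` hemisphere u) `|dot w x| = width K w / 2.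
Proof.
move=> u0 eu we; rewrite /width (half_integral e1 K1 mK K_refl u0 eu
  (measurable_norm_dot w) (M := enorm w)).
- by rewrite mulrC mulrA mulVf ?mul1r// pnatr_eq0.
- by move=> x.
- move=> x; rewrite dot_sph_reflection; case: we => [we|->].
    by rewrite (dotC w e) we mulr0 addr0 normrN.
  by rewrite unit_sphere_dot// (dotC x e); congr Num.norm; ring.
- by move=> x /K1; exact: dot_unit_le.
Qed.

Lemma dot_center_half_moment u : u != 0 -> dot e u = 0 ->
  dot e (half_moment K u) = width K e / 2.
Proof.
move=> u0 eu; rewrite dot_half_moment -(half_width u0 eu (or_intror erefl)).
by apply: eq_Rintegral => x; rewrite inE => -[/K_ge0 ex _]; rewrite ger0_norm.
Qed.

Lemma dot_half_moment_le w u : u != 0 -> dot e u = 0 -> dot e w = 0 ->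
  `|dot w (half_moment K u)| <= width K w / 2.
Proof.
move=> u0 eu ew; rewrite dot_half_moment -(half_width u0 eu (or_introl ew)).
by apply: le_normr_Rintegral => //; exact: integrable_dot.
Qed.

(** The integrand does not change sign on [hemisphere u], so [dot_half_moment_le] is sharp at
    [w = u]. *)
Lemma dot_half_moment_self u : u != 0 -> dot e u = 0 ->
  dot u (half_moment K u) = width K u / 2.
Proof.
move=> u0 eu; rewrite dot_half_moment -(half_width u0 eu (or_introl eu)).
by apply: eq_Rintegral => x; rewrite inE => -[_ [_ ux]]; rewrite ger0_norm.
Qed.

End symmetric.
End moments.

Section width_positive.
Context {R : realType} {n : nat}.
Local Notation sigma := (@spherical_measure R n).
Variable K : set 'rV[R]_n.
Hypotheses (K1 : K `<=` unit_sphere) (cK : closed K).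
Hypothesis K_int : rel_interior unit_sphere K !=set0.

(** The integrand vanishes only on a hyperplane, and what remains of [K] outside it has positive
    measure because [K] has interior points. *)
Lemma width_gt0 w : w != 0 -> 0 < width K w.
Proof.
move=> w0; have mK := measurable_closed_row cK.
have mw0 : measurable (orthogonal_compl w) by exact: measurable_orthogonal_compl.
pose A := K `\` orthogonal_compl w.
have mA : measurable A by exact: measurableD.
have [x wx Sx] : exists2 x, dot w x != 0 & nbhs x [set y | K (normalize y)].
  have [x xK] := K_int; have x1 : unit_sphere x by case: xK.
  move/(rel_interior_sphereP _ x1) : xK => xK.
  have [wx|wx] := eqVneq (dot w x) 0; last by exists x.
  (* Here [x] lies on the hyperplane: a small step along [w] leaves the hyperplane but not the
     interior. *)
  have xKK : nbhs x [set y | nbhs y [set z | K (normalize z)]].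
    exact: nbhs_interior.
  have : (x + t *: w) @[t --> (0 : R)] --> x.
    rewrite -[X in _ --> X]addr0 -[X in x + X](scale0r w).
    by apply: cvgD; [exact: cvg_cst|apply: cvgZr_tmp; exact: cvg_id].
  move=> /(_ _ xKK) /nbhs_ballP[r /= r0 h].
  have r20 : 0 < r / 2 by rewrite divr_gt0.
  exists (x + (r / 2) *: w).
    by rewrite dotDr wx add0r dotZr mulf_neq0 ?gt_eqF// dot_gt0.
  apply: h; rewrite /ball/= sub0r normrN gtr0_norm//.
  by rewrite ltr_pdivrMr// ltr_pMr// ltr1n.
have x0 : x != 0 by apply: contraNneq wx => ->; rewrite dot0r.
have sA : (0 < sigma A)%E.
  apply: (spherical_measure_cone_gt0 mA x0).
  have w2 : nbhs x [set y | 0 < `|dot w y|].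
    apply: (@nbhs_gt0 _ _ (fun y => `|dot w y|)); last by rewrite normr_gt0.
    by apply: continuous_comp; [exact: (@continuous_dot R n w x)|exact: norm_continuous].
  apply: filterS2 Sx w2 => y /= Ky wy; split => //.
  rewrite /orthogonal_compl/= dot_normalize => /eqP; rewrite mulf_eq0 invr_eq0.
  rewrite enorm_eq0 => /orP[/eqP y0|/eqP wy0].
    by move: wy; rewrite y0 dot0r normr0 ltxx.
  by move: wy; rewrite wy0 normr0 ltxx.
rewrite lt_neqAle width_ge0 andbT eq_sym; apply/eqP => width0.
have : (\int[sigma]_(x in K) `|(dot w x)%:E| = 0)%E.
  have := integrable_fin_num mK (integrable_norm_dot K1 mK w) => fin.
  by rewrite -[LHS](fineK fin); congr _%:E.
have mdw : measurable_fun K (fun x => (dot w x)%:E).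
  by apply: (measurable_funS measurableT) => //; apply/measurable_EFinP; exact: measurable_dot_id.
move=> /(ae_eq_integral_abs _ mK mdw)[N [mN N0 KN]].
have := subset_measure0 mA mN _ N0.
move=> /(_ _)/eqP; rewrite gt_eqF// => /(_ _)/negP; apply => //.
move=> y [Ky wy]; apply: KN => /= /(_ Ky)[]; exact: wy.
Qed.

End width_positive.

(** * Uniqueness of the touching point in a support direction *)

Section support_point.
Context {R : realType} {n : nat}.
Local Notation sigma := (@spherical_measure R n).
Variables (e : 'rV[R]_n) (K : set 'rV[R]_n).
Hypotheses (e1 : unit_sphere e) (K1 : K `<=` unit_sphere) (cK : closed K).
Hypothesis K_refl : forall x, K x -> K (sph_reflection e x).
Hypothesis K_ge0 : forall x, K x -> 0 <= dot e x.

Let mK : measurable K. Proof. exact: measurable_closed_row. Qed.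
Let mKu u : measurable (K `&` hemisphere u). Proof. exact: measurable_half. Qed.

Let slab u (r : R) := K `&` [set x | `|dot u x| <= r].

Let measurable_slab u r : measurable (slab u r).
Proof.
apply: measurableI => //; rewrite (_ : mkset _ = (fun x => `|dot u x|) @^-1` `]-oo, r]%classic).
  by rewrite -[X in measurable X]setTI; exact: measurable_norm_dot.
by apply/seteqP; split => x /=; rewrite in_itv.
Qed.

(** The halves for [u] and [u'] differ only where [dot u x] and [dot u' x] have different signs,
    which forces [|dot u x| <= |u' - u|]; there the integrand is at most [enorm z]. *)
Let dot_half_moment_diff z u u' :
  dot z (half_moment K u') - dot z (half_moment K u) <=
  enorm z * fine (sigma (slab u (enorm (u' - u)))).
Proof.
set r := enorm (u' - u); have msl := measurable_slab u r.
have E v : \int[sigma]_(x in K `&` hemisphere v) dot z x =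
    \int[sigma]_(x in K) (dot z \_ (K `&` hemisphere v)) x.
  rewrite -[RHS]Rintegral_mkcondr; congr (fine (integral _ _ _)).
  by rewrite (setIA K K) setIid.
have le1 (B : set 'rV[R]_n) x : K x -> `|(dot z \_ B) x| <= enorm z.
  move=> /K1 x1; rewrite patchE; case: ifPn => _; first exact: dot_unit_le.
  by rewrite normr0 enorm_ge0.
have mE v : measurable_fun setT (dot z \_ (K `&` hemisphere v)).
  apply: (iffLR (measurable_restrictT _ (mKu v))).
  by apply: (measurable_funS measurableT) => //; exact: measurable_dot_id.
have iE v := bounded_integrable_spherical mK (mE v) (le1 (K `&` hemisphere v)).
rewrite !(dot_half_moment K1 cK) !E -RintegralB// -Rintegral_cst//.
have -> : \int[sigma]_(x in slab u r) enorm z =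
    \int[sigma]_(x in K) ((cst (enorm z)) \_ (slab u r)) x.
  rewrite -[RHS]Rintegral_mkcondr; congr (fine (integral _ _ _)).
  by rewrite /slab (setIA K K) setIid.
have lec (B : set 'rV[R]_n) x : K x -> `|(cst (enorm z) \_ B) x| <= enorm z.
  move=> _; rewrite patchE; case: ifPn => _; last by rewrite normr0 enorm_ge0.
  by rewrite ger0_norm// enorm_ge0.
have mc : measurable_fun setT (cst (enorm z) \_ (slab u r)).
  apply: (iffLR (measurable_restrictT _ msl)).
  exact: measurable_cst.
apply: le_Rintegral => //.
- apply: (@bounded_integrable_spherical _ _ _ _ (enorm z + enorm z)) => //.
    exact: measurable_funB.
  by move=> x Kx; rewrite (le_trans (ler_normB _ _))// lerD// le1.
- exact: (bounded_integrable_spherical mK mc (lec _)).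
move=> x Kx; have x1 := K1 Kx; rewrite !patchE.
have memK v : (x \in K `&` hemisphere v) = (0 <= dot v x).
  apply/idP/idP; first by rewrite inE => -[_ []].
  by move=> vx; rewrite inE.
have := dot_unit_le z x1; have z0 := enorm_ge0 z.
rewrite ler_norml => /andP[zx1 zx2].
rewrite !memK; case: (boolP (x \in slab u r)) => [_|].
  by case: ifPn => _; case: ifPn => _ /=; rewrite -?[point]/(0 : R); lra.
rewrite notin_setE => nx.
have ux : r < `|dot u x| by rewrite ltNge; apply/negP => ux; apply: nx.
have u'x : `|dot u' x - dot u x| <= r by rewrite -dotNl -dotDl dot_unit_le.
suff -> : (0 <= dot u' x) = (0 <= dot u x) by rewrite subrr.
move: ux u'x; rewrite ler_norml => + /andP[u1 u2].
by case: (ger0P (dot u x)) => ux ux'; [apply/idP|apply/negbTE]; rewrite -?ltNge; lra.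
Qed.

(* [x] and the moment of the half-space of [u + t *: z], [z := x - half_moment K u],
   both lie in the width body; comparing their support values in directions [u]
   and [u + t *: z] bounds [dot z z] by the measure of a slab of thickness [t]. *)
Lemma half_moment_support u x : u != 0 -> dot e u = 0 ->
  dot e x = width K e / 2 ->
  (forall w, dot e w = 0 -> dot w x <= width K w / 2) ->
  dot u x = width K u / 2 -> x = half_moment K u.
Proof.
move=> u0 eu ex x_le ux; apply/eqP; rewrite -subr_eq0.
set z := x - half_moment K u.
have ez : dot e z = 0.
  by rewrite dotDr dotNr ex (dot_center_half_moment e1 K1 cK)// subrr.
have uz : dot u z = 0.
  by rewrite dotDr dotNr ux (dot_half_moment_self e1 K1 cK)// subrr.
apply/negPn/negP => z0; have ez0 : 0 < enorm z by rewrite enorm_gt0.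
have slab_ge t : 0 < t -> enorm z <= fine (sigma (slab u (t * enorm z))).
  move=> t0; pose u' := u + t *: z.
  have u'0 : u' != 0.
    apply: contraTneq u0 => u'0; rewrite negbK -enorm_eq0 -sqrf_eq0 enorm_sqr.
    by have := dot0r u; rewrite -u'0 dotDr dotZr uz mulr0 addr0 => ->.
  have eu' : dot e u' = 0 by rewrite dotDr dotZr eu ez mulr0 addr0.
  (* In direction [u'] the half moment of [u'] does at least as well as [x], in direction [u] at
     most as well; subtracting leaves the comparison in direction [z]. *)
  have := x_le _ eu'; rewrite -(dot_half_moment_self e1 K1 cK K_refl u'0 eu').
  rewrite dotDl [in X in _ <= X]dotDl ux !dotZl.
  have := dot_half_moment_le e1 K1 cK K_refl u'0 eu' eu.
  rewrite ler_norml => /andP[_ h1] h2.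
  have h3 : dot z x <= dot z (half_moment K u').
    by rewrite -(ler_pM2l t0); lra.
  have := dot_half_moment_diff z u u'.
  rewrite (_ : u' - u = t *: z) ?enormZ ?gtr0_norm//; last first.
    by rewrite /u' addrC addKr.
  move=> h4; rewrite -(ler_pM2l ez0) (le_trans _ h4)// -expr2 enorm_sqr.
  by rewrite {2}/z dotDr dotNr lerD2r.
(* These slabs decrease to the part of [K] orthogonal to [u], a null set, so [slab_ge] gives
   [enorm z <= 0] in the limit. *)
pose F k := slab u (k.+1%:R^-1 * enorm z).
have mF k : measurable (F k) by exact: measurable_slab.
have mcapF : measurable (\bigcap_k F k) by exact: bigcapT_measurable.
have F0 : sigma (\bigcap_k F k) = 0%E.
  apply: (subset_measure0 mcapF (measurable_orthogonal_compl u) _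
    (spherical_measure_hyperplane0 u0)) => y Fy.
  apply/eqP; rewrite -normr_le0; apply/ler_addgt0Pr => eps eps0; rewrite add0r.
  have [k ke] : exists k : nat, k.+1%:R^-1 * enorm z < eps.
    exists (Num.truncn (enorm z / eps)); rewrite ltr_pdivrMl ?ltr0n//.
    by rewrite -ltr_pdivrMr// truncnS_gt.
  by have [_] := Fy k Logic.I; move=> /le_trans; apply; exact: ltW.
have ndF : nonincreasing_seq F.
  move=> i j ij; apply/subsetPset => y [Ky yj]; split => //.
  rewrite /= (le_trans yj)// ler_wpM2r ?enorm_ge0//.
  by rewrite lef_pV2 ?posrE ?ltr0n// ler_nat.
have F0y : (sigma (F 0%N) < +oo)%E by exact: spherical_measure_lty.
have cvgF0 : (fun k => sigma (F k)) @ \oo --> 0%E.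
  by rewrite -F0; exact: (nonincreasing_cvg_mu F0y mF mcapF ndF).
have : ((enorm z)%:E <= 0)%E.
  rewrite -(cvg_lim _ cvgF0)//; apply: lime_ge; first by apply/cvg_ex; exists 0%E.
  apply: nearW => k /=.
  have /fineK <- : sigma (F k) \is a fin_num.
    by rewrite ge0_fin_numE ?measure_ge0//; exact: spherical_measure_lty.
  by rewrite lee_fin; apply: slab_ge; rewrite invr_gt0 ltr0n.
by rewrite lee_fin leNgt ez0.
Qed.

End support_point.

(** * Spherical convexity and boundaries *)

Section spherical_convexity.
Context {R : realType} {n : nat}.
Implicit Types (A : set 'rV[R]_n) (x y u v w e d : 'rV[R]_n).

Lemma convex_rowP A : convex_row A <->
  forall x y (t : R), A x -> A y -> 0 <= t <= 1 -> A (t *: x + (1 - t) *: y).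
Proof.
split=> [cA x y t Ax Ay /andP[t0 t1]|cA x y k xA yA].
  have := cA x y (Itv01 t0 t1) (mem_set Ax) (mem_set Ay).
  by rewrite inE.
apply/mem_set; apply: cA; [exact: set_mem|exact: set_mem|].
by apply/andP; split.
Qed.

(** A name for the set whose convexity is [sph_convex]; as a cone, it turns convexity into stability
    under sums. *)
Definition sph_cone A : set 'rV[R]_n :=
  [set l *: u | l in [set l : R | 0 <= l] & u in A].

Lemma sph_coneZ A x t : 0 <= t -> sph_cone A x -> sph_cone A (t *: x).
Proof.
move=> t0 [l /= l0] [u Au <-]; exists (t * l); first by rewrite /= mulr_ge0.
by exists u => //; rewrite scalerA.
Qed.

Lemma sph_coneD A x y : sph_convex A -> sph_cone A x -> sph_cone A y ->
  sph_cone A (x + y).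
Proof.
move=> /convex_rowP cA Ax Ay.
have -> : x + y = 2 *: (2^-1 *: x + (1 - 2^-1) *: y).
  by rewrite scalerDr !scalerA mulfV ?pnatr_eq0// mulrBr mulfV ?pnatr_eq0//
    mulr1 (_ : 2 - 1 = 1) ?scale1r//; ring.
apply: sph_coneZ => //; apply: cA => //.
by rewrite invr_ge0 ler0n/= invf_le1 ?ltr0n// ler1n.
Qed.

Lemma sub_sph_cone A : A `<=` sph_cone A.
Proof.
by move=> x Ax; exists 1; [rewrite /= ler01|exists x => //; rewrite scale1r].
Qed.

Lemma sph_cone_normalize A x : A `<=` unit_sphere -> x != 0 ->
  sph_cone A x -> A (normalize x).
Proof.
move=> A1 + [l /= l0] [u Au xE]; rewrite -xE scaler_eq0 negb_or => /andP[ln0 _].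
rewrite normalizeZ ?lt_neqAle 1?eq_sym ?ln0 ?l0//.
by rewrite normalize_unit//; exact: A1.
Qed.

(** The crossing is at the last time spent in [A]: closedness puts that point in [A], and were it
    interior, slightly later points would be in [A] too. *)
Lemma path_crosses_boundary A (f : R -> 'rV[R]_n) : closed A ->
  (forall t, 0 <= t <= 1 -> {for t, continuous f}) ->
  (forall t, 0 <= t <= 1 -> unit_sphere (f t)) ->
  A (f 0) -> ~ A (f 1) ->
  exists t, 0 <= t < 1 /\ rel_boundary unit_sphere A (f t).
Proof.
move=> cA cf f1 Af0 nAf1.
pose E := [set t : R | 0 <= t <= 1 /\ A (f t)].
have E0 : E 0 by split; rewrite ?lexx ?ler01.
have ubE : ubound E 1 by move=> t [/andP[]].
have supE : has_sup E by split; [exists 0|exists 1].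
set s := sup E.
have s01 : 0 <= s <= 1.
  apply/andP; split; first exact: (ub_le_sup (ex_intro _ 1 ubE) E0).
  by apply: ge_sup ubE; exists 0.
have Afs : A (f s).
  rewrite ((closure_id A).1 cA) => U fsU.
  have /nbhs_ballP[r /= r0 h] := cf s s01 _ fsU.
  have [t Et st] := sup_adherent r0 supE.
  exists (f t); split; first by case: Et.
  apply: h; rewrite /ball/= ger0_norm ?subr_ge0; last exact: (ub_le_sup (ex_intro _ 1 ubE)).
  by rewrite ltrBlDr addrC -ltrBlDr.
have s1 : s < 1.
  rewrite lt_neqAle (andP s01).2 andbT; apply/eqP => s1.
  by apply: nAf1; rewrite -s1.
exists s; split; first by rewrite (andP s01).1.
split; first by split; [exact: subset_closure|exact: f1].
move=> [_ intA].
have /nbhs_ballP[r /= r0 h] := cf s s01 _ intA.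
(* A later time that is still in the unit interval and in the neighbourhood of [s]. *)
pose t := s + Num.min (r / 2) (1 - s).
have m0 : 0 < Num.min (r / 2) (1 - s) by rewrite lt_min divr_gt0// subr_gt0.
have t01 : 0 <= t <= 1.
  rewrite addr_ge0 ?(ltW m0) ?(andP s01).1//=.
  by rewrite /t -lerBrDl ge_min lexx orbT.
have Et : E t.
  split => //; apply: h; last exact: f1.
  rewrite /ball/= /t opprD addrA subrr sub0r normrN gtr0_norm//.
  by rewrite gt_min ltr_pdivrMr// ltr_pMr// ltr1n.
have := ub_le_sup (ex_intro _ 1 ubE) Et; rewrite -/s /t.
by rewrite leNgt ltrDl m0.
Qed.

End spherical_convexity.

(** * Bodies determined by their boundary *)

Section unique_boundary.
Context {R : realType} {n : nat}.
Implicit Types (A : set 'rV[R]_n) (x y u v w d : 'rV[R]_n).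

Lemma segment_crosses_boundary A x y : closed A -> unit_sphere x -> unit_sphere y ->
  (forall t : R, 0 <= t <= 1 -> (1 - t) *: x + t *: y != 0) ->
  A x -> ~ A y ->
  exists t : R, 0 <= t < 1 /\
    rel_boundary unit_sphere A (normalize ((1 - t) *: x + t *: y)).
Proof.
move=> cA x1 y1 xy0 Ax nAy.
apply: (@path_crosses_boundary _ _ A (fun t => normalize ((1 - t) *: x + t *: y)) cA).
- move=> t t01; apply: (@cvg_normalize _ _ _ _ _ (fun t => (1 - t) *: x + t *: y)).
    exact: xy0.
  apply: cvgD; apply: cvgZr_tmp; last exact: cvg_id.
  by apply: cvgB; [exact: cvg_cst|exact: cvg_id].
- by move=> t t01; apply: enorm_normalize; exact: xy0.
- by rewrite subr0 scale1r scale0r addr0 normalize_unit.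
- by rewrite subrr scale0r scale1r add0r normalize_unit.
Qed.

Variables (e : 'rV[R]_n).
Hypothesis e1 : unit_sphere e.

(** A path within [dot e x <= 0] never meets the boundary. One point of [A] there would spread to
    that whole closed hemisphere, and convexity with a boundary point [b] would then fill the
    sphere. *)
Lemma body_in_open_hemisphere A : sph_convex_body A ->
  rel_boundary unit_sphere A `<=` [set x | 0 < dot e x] ->
  rel_boundary unit_sphere A !=set0 ->
  forall x, A x -> 0 < dot e x.
Proof.
move=> [A1 cA convA AT _] bdA [b bdb] v Av.
have ee := unit_sphere_dot e1.
have Ab : A b by case: bdb => -[]; rewrite -((closure_id A).1 cA).
have eb : 0 < dot e b by exact: bdA.
have spread x y : A x -> dot e x <= 0 -> unit_sphere y -> dot e y <= 0 ->
    (forall t : R, 0 <= t <= 1 -> (1 - t) *: x + t *: y != 0) -> A y.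
  move=> Ax ex y1 ey xy0; apply: contrapT => nAy.
  have [t [/andP[t0 t1]]] := segment_crosses_boundary cA (A1 _ Ax) y1 xy0 Ax nAy.
  move=> /bdA/=; rewrite dot_normalize dotDr !dotZr pmulr_rgt0; last first.
    by rewrite invr_gt0 enorm_gt0 xy0// t0 ltW.
  have h1 : (1 - t) * dot e x <= 0 by rewrite mulr_ge0_le0// subr_ge0 ltW.
  have h2 : t * dot e y <= 0 by rewrite mulr_ge0_le0.
  by move=> h3; clear - h1 h2 h3; lra.
rewrite ltNge; apply/negP => ev; apply: AT; apply/seteqP; split => [//|].
have e1N : unit_sphere (- e) by apply: unit_sphere_dotP; rewrite dotNl dotNr opprK.
have eeN : dot e (- e) <= 0 by rewrite dotNr ee lerN10.
(* The spreading passes through [- e], since a direct segment from [v] to an antipodal target would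
   hit the origin. *)
have ANe : A (- e).
  apply: (spread v) => // t /andP[t0 t1]; apply/eqP => xt0.
  have := dot0r e; rewrite -xt0 dotDr !dotZr dotNr ee mulrN1 => h.
  have h1 : (1 - t) * dot e v <= 0 by rewrite mulr_ge0_le0// subr_ge0.
  have t00 : t = 0 by clear - h h1 t0; lra.
  move: xt0; rewrite t00 subr0 scale1r scale0r addr0 => /eqP.
  exact/negP/(unit_sphere_neq0 (A1 _ Av)).
have Alow y : unit_sphere y -> dot e y <= 0 -> A y.
  move=> y1 ey; apply: (spread (- e)) => // t /andP[t0 t1]; apply/eqP => xt0.
  have := dot0r e; rewrite -xt0 dotDr !dotZr dotNr ee mulrN1 => h.
  have h1 : t * dot e y <= 0 by rewrite mulr_ge0_le0.
  have t11 : t = 1 by clear - h h1 t1; lra.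
  move: xt0; rewrite t11 subrr scale1r scale0r add0r => /eqP.
  exact/negP/(unit_sphere_neq0 y1).
move=> x x1; have [ex|ex] := leP (dot e x) 0; first exact: Alow.
have x0 := unit_sphere_neq0 x1.
(* Chosen so that [x - s *: b] is orthogonal to [e]; then [x] is a sum of a point over the filled
   hemisphere and a multiple of [b]. *)
pose s := dot e x / dot e b.
have s0 : 0 < s by rewrite divr_gt0.
have ey : dot e (x - s *: b) = 0.
  by rewrite dotDr dotNr dotZr /s divfK ?subrr// gt_eqF.
rewrite -(normalize_unit x1); apply: (sph_cone_normalize A1 x0).
rewrite -[x](subrK (s *: b)); apply: sph_coneD => //; last first.
  by apply: sph_coneZ; [exact: ltW|exact: sub_sph_cone].
have [->|y0] := eqVneq (x - s *: b) 0.
  by rewrite -(scale0r b); apply: sph_coneZ => //; exact: sub_sph_cone.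
rewrite [X in sph_cone _ X]scale_normalize; apply: sph_coneZ; first exact: enorm_ge0.
apply: sub_sph_cone; apply: Alow; first exact: enorm_normalize.
by rewrite dot_normalize ey mulr0.
Qed.

(** Going from [x] towards [d] and towards [- d], both outside [A], one crosses the boundary twice;
    [x] lies in the cone spanned by the two crossing points, which belong to [A']. *)
Lemma sub_same_boundary A A' d : sph_convex_body A -> sph_convex_body A' ->
  rel_boundary unit_sphere A `<=` A' ->
  (forall x, A x -> 0 < dot e x) ->
  unit_sphere d -> dot e d = 0 -> A `<=` A'.
Proof.
move=> [A1 cA _ _ _] [A'1 _ convA' _ _] bdAA' Ae d1 ed x Ax.
have x1 := A1 _ Ax; have ex := Ae _ Ax.
have exit c : unit_sphere c -> dot e c = 0 ->
    exists t : R, 0 <= t < 1 /\ sph_cone A' ((1 - t) *: x + t *: c).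
  move=> c1 ec.
  have nz t : 0 <= t <= 1 -> (1 - t) *: x + t *: c != 0.
    move=> t01; apply/eqP => xt0.
    have /eqP := dot0r e; rewrite -xt0 dotDr !dotZr ec mulr0 addr0.
    rewrite mulf_eq0 (gt_eqF ex) orbF subr_eq0 => /eqP t1.
    move: xt0; rewrite -t1 subrr scale1r scale0r add0r => /eqP.
    exact/negP/(unit_sphere_neq0 c1).
  have nAc : ~ A c by move=> /Ae; rewrite ec ltxx.
  have [t [t01 bdt]] := segment_crosses_boundary cA x1 c1 nz Ax nAc.
  exists t; split => //; rewrite [X in sph_cone _ X]scale_normalize.
  apply: sph_coneZ; first exact: enorm_ge0.
  exact/sub_sph_cone/bdAA'.
have dN1 : unit_sphere (- d) by apply: unit_sphere_dotP; rewrite dotNl dotNr opprK unit_sphere_dot.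
have edN : dot e (- d) = 0 by rewrite dotNr ed oppr0.
have [t [/andP[t0 t1] At]] := exit _ d1 ed.
have [s [/andP[s0 s1] As]] := exit _ dN1 edN.
rewrite -(normalize_unit x1); apply: (sph_cone_normalize A'1 (unit_sphere_neq0 x1)).
(* If [s = 0], the crossing point is [x] itself. *)
have [s00|s00] := eqVneq s 0.
  by move: As; rewrite s00 subr0 scale1r scale0r addr0.
have sp : 0 < s by rewrite lt_neqAle eq_sym s00.
have k0 : 0 < s * (1 - t) + t * (1 - s).
  by rewrite ltr_pwDl ?mulr_gt0 ?mulr_ge0 ?subr_gt0// subr_ge0 ltW.
(* The weights [s] and [t] cancel [d]; the coefficient left on [x] is positive because [s > 0] and
   [t < 1]. *)
have := sph_coneD convA' (sph_coneZ s0 At) (sph_coneZ t0 As).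
have -> : s *: ((1 - t) *: x + t *: d) + t *: ((1 - s) *: x + s *: - d) =
    (s * (1 - t) + t * (1 - s)) *: x.
  by apply/rowP => i; rewrite !mxE; ring.
move=> /(sph_coneZ (ltW (_ : 0 < (s * (1 - t) + t * (1 - s))^-1))).
by rewrite scalerA mulVf ?gt_eqF// scale1r; apply; rewrite invr_gt0.
Qed.

End unique_boundary.

(** * The centroid body *)

Section great_subsphere_theory.
Context {R : realType} {n : nat}.

Lemma exists_unit_orthogonal (e : 'rV[R]_n.+1) : (0 < n)%N -> unit_sphere e ->
  great_subsphere e !=set0.
Proof.
move=> n0 e1; have [B [BB Be]] := exists_orthonormal_frame e1.
pose i : 'I_n := Ordinal n0; exists (row i B); split.
  apply: unit_sphere_dotP; rewrite dotE.
  have -> : 1 = (B *m B^T) i i by rewrite BB mxE eqxx.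
  by rewrite [RHS]mxE; apply: eq_bigr => j _; rewrite !mxE.
rewrite /orthogonal_compl/= dotC dotE.
transitivity ((B *m e^T) i 0); last by rewrite Be mxE.
by rewrite [RHS]mxE; apply: eq_bigr => j _; rewrite !mxE.
Qed.

Lemma closed_unit_sphere m : closed (@unit_sphere R m).
Proof.
rewrite (_ : unit_sphere = @enorm R m @^-1` [set 1])//.
by apply: closed_comp => [x _|]; [exact: continuous_enorm|exact: closed_eq].
Qed.

Lemma compact_sub_sphere m (A : set 'rV[R]_m) :
  A `<=` unit_sphere -> closed A -> compact A.
Proof.
move=> A1; apply: bounded_closed_compact; exists 1; split; first exact: num_real.
move=> r r1 x /A1 x1 /=; rewrite [`|x|]mx_normrE.
apply/bigmax_leP; split => [|[i j] _]; first by rewrite (le_trans ler01)// ltW.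
by rewrite (ord1 i) (le_trans (coord_le_enorm _ _))// x1 ltW.
Qed.

Lemma compact_great_subsphere m (e : 'rV[R]_m) : compact (great_subsphere e).
Proof.
apply: compact_sub_sphere => [x []//|].
apply: closedI; first exact: closed_unit_sphere.
rewrite (_ : orthogonal_compl e = dot e @^-1` [set 0])//.
by apply: closed_comp => [x _|]; [exact: continuous_dot|exact: closed_eq].
Qed.

End great_subsphere_theory.

Section width_continuous.
Context {R : realType} {n : nat}.
Variable K : set 'rV[R]_n.
Hypotheses (K1 : K `<=` unit_sphere) (cK : closed K).

Lemma continuous_width : continuous (width K).
Proof.
move=> w; set C := fine (spherical_measure K).
have FF : Filter (nbhs w) := nbhs_filter w.
apply/cvgrPdist_lt => eps eps0.
have : enorm (w - w') * C @[w' --> w] --> enorm (w - w) * C.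
  apply: cvgMr_tmp; apply: (@cvg_enorm _ _ _ _ _ (fun w' => w - w')).
  by apply: cvgB; [exact: cvg_cst|exact: cvg_id].
rewrite subrr (_ : enorm 0 = 0) ?mul0r; last by apply/eqP; rewrite enorm_eq0.
move=> /cvgrPdist_lt/(_ _ eps0).
apply: (@filterS _ (nbhs w) (nbhs_filter w)) => w' /=.
rewrite sub0r normrN; apply: le_lt_trans.
by rewrite (le_trans (width_lipschitz K1 cK _ _))// ler_norm.
Qed.

End width_continuous.

Section centroid_body.
Context {R : realType} {n : nat}.
Variables (e : 'rV[R]_n.+1) (K : set 'rV[R]_n.+1).
Hypothesis n0 : (0 < n)%N.
Hypothesis e1 : unit_sphere e.
Hypotheses (K1 : K `<=` unit_sphere) (cK : closed K).
Hypothesis K_int : rel_interior unit_sphere K !=set0.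
Hypothesis K_refl : forall x, K x -> K (sph_reflection e x).
Hypothesis K_ge0 : forall x, K x -> 0 <= dot e x.

Local Notation W := (width K).
Local Notation T := (width K e).

Let T0 : 0 < T. Proof. exact/(width_gt0 K1 cK K_int)/unit_sphere_neq0. Qed.
Let ee : dot e e = 1. Proof. exact: unit_sphere_dot. Qed.

(** Divided by [dot e x], the inequality says that the gnomonic image satisfies
    [|dot w y| <= width K w / width K e]. The product form is homogeneous and also makes sense on
    the equator of [e]. *)
Definition centroid_cone : set 'rV[R]_n.+1 :=
  [set x | forall w, dot e w = 0 -> `|dot w x| * T <= W w * dot e x].

Definition centroid_body : set 'rV[R]_n.+1 := unit_sphere `&` centroid_cone.

Lemma centroid_coneZ t x : 0 <= t -> centroid_cone x -> centroid_cone (t *: x).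
Proof.
move=> t0 Cx w ew; rewrite !dotZr normrM ger0_norm// -mulrA [leRHS]mulrCA.
by rewrite ler_wpM2l// Cx.
Qed.

Lemma centroid_coneD x y : centroid_cone x -> centroid_cone y ->
  centroid_cone (x + y).
Proof.
move=> Cx Cy w ew; rewrite !dotDr mulrDr.
rewrite (le_trans _ (lerD (Cx _ ew) (Cy _ ew)))// -mulrDl.
by rewrite ler_wpM2r ?(ltW T0)// ler_normD.
Qed.

Lemma centroid_cone_normalize x : x != 0 -> centroid_cone x ->
  centroid_body (normalize x).
Proof.
move=> x0 Cx; split; first exact: enorm_normalize.
by apply: centroid_coneZ => //; rewrite invr_ge0 enorm_ge0.
Qed.

(** Any direction [d] orthogonal to [e] forces [dot e x >= 0]. If [dot e x = 0], then [x] is itself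
    an admissible direction, and its constraint reads [width K e <= 0]. *)
Lemma centroid_body_gt0 x : centroid_body x -> 0 < dot e x.
Proof.
move=> [x1 Cx]; have [d [d1 ed]] := exists_unit_orthogonal n0 e1.
have Wd := width_gt0 K1 cK K_int (unit_sphere_neq0 d1).
rewrite lt_neqAle; apply/andP; split; last first.
  by rewrite -(pmulr_rge0 _ Wd) (le_trans _ (Cx _ ed))// mulr_ge0// ltW.
apply/eqP => ex; have := Cx x (esym ex).
by rewrite -ex mulr0 unit_sphere_dot// normr1 mul1r leNgt T0.
Qed.

Lemma sph_cone_centroid_body : sph_cone centroid_body = centroid_cone.
Proof.
apply/seteqP; split => [_ [l l0] [x [_ Cx] <-]|x Cx].
  exact: centroid_coneZ.
have [->|x0] := eqVneq x 0.
  exists 0 => //=; exists e; last by rewrite scale0r.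
  split => // w ew; rewrite dotC ew normr0 mul0r ee mulr1.
  exact: width_ge0.
rewrite [x]scale_normalize; apply: sph_coneZ; first exact: enorm_ge0.
by apply: sub_sph_cone; exact: centroid_cone_normalize.
Qed.

Lemma sph_convex_centroid_body : sph_convex centroid_body.
Proof.
rewrite /sph_convex -/(sph_cone _) sph_cone_centroid_body.
apply/convex_rowP => x y t Cx Cy /andP[t0 t1].
by apply: centroid_coneD; apply: centroid_coneZ => //; rewrite subr_ge0.
Qed.

Lemma closed_centroid_body : closed centroid_body.
Proof.
apply: closedI; first exact: closed_unit_sphere.
rewrite (_ : centroid_cone = \bigcap_(w in [set w | dot e w = 0])
    (fun x => W w * dot e x - `|dot w x| * T) @^-1` [set r | 0 <= r]); last first.
  by apply/seteqP; split => x Cx w /Cx; rewrite /= subr_ge0.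
apply: closed_bigI => w _; apply: closed_comp; last exact: closed_ge.
move=> x _; have FF : Filter (nbhs x) := nbhs_filter x.
apply: cvgB.
  by apply: cvgMl_tmp; exact: (@continuous_dot _ _ e x).
apply: cvgMr_tmp.
by apply: continuous_comp; [exact: (@continuous_dot _ _ w x)|exact: norm_continuous].
Qed.

Let strict_cone v := forall w, great_subsphere e w -> `|dot w v| * T < W w * dot e v.

(** Compactness of the set of unit directions makes the strict inequalities hold uniformly near [v];
    homogeneity in [w] then covers all directions. *)
Lemma centroid_body_interior v : unit_sphere v -> strict_cone v ->
  rel_interior unit_sphere centroid_body v.
Proof.
move=> v1 Cv; split => //; rewrite /within/=.
have cov := (compact_near_coveringP _).1 (@compact_great_subsphere _ _ e).
have FF : Filter (nbhs v) := nbhs_filter v.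
have near_v : nbhs v [set v' | great_subsphere e `<=`
    [set w | 0 < W w * dot e v' - `|dot w v'| * T]].
  apply: (cov _ (nbhs v)
    (fun v' w => 0 < W w * dot e v' - `|dot w v'| * T) FF) => w Sw.
  have Fw : Filter (nbhs w) := nbhs_filter w.
  pose Phi (p : 'rV[R]_n.+1 * 'rV[R]_n.+1) := W p.1 * dot e p.2 - `|dot p.1 p.2| * T.
  suff : \forall p \near (w, v), 0 < Phi p by [].
  apply: (@nbhs_gt0 _ _ Phi (w, v)); last by rewrite subr_gt0; exact: Cv.
  have cfst : fst p @[p --> (w, v)] --> w by exact: cvg_fst.
  have csnd : snd p @[p --> (w, v)] --> v by exact: cvg_snd.
  apply: cvgB; first apply: cvgM.
  - apply: (cvg_comp _ W cfst); exact: continuous_width.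
  - apply: (cvg_comp _ (dot e) csnd); exact: continuous_dot.
  - apply: cvgMr_tmp; apply: cvg_norm; exact: cvg_dot.
apply: filterS near_v => v' Hv' v'1; split => // w ew.
have [->|w0] := eqVneq w 0.
  have -> : W 0 = 0 by rewrite -(scale0r e) widthZ// normr0 mul0r.
  by rewrite dot0l normr0 !mul0r.
have Sw : great_subsphere e (normalize w).
  by split; [exact: enorm_normalize|rewrite /orthogonal_compl/= dot_normalize ew mulr0].
rewrite [w]scale_normalize widthZ// dotZl normrM -!mulrA ler_wpM2l//.
by have := Hv' _ Sw; rewrite /= subr_gt0; exact: ltW.
Qed.

Lemma center_interior : rel_interior unit_sphere centroid_body e.
Proof.
apply: centroid_body_interior => // w [w1 ew].
rewrite dotC ew normr0 mul0r ee mulr1.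
exact/(width_gt0 K1 cK K_int)/unit_sphere_neq0.
Qed.

Lemma sph_convex_body_centroid_body : sph_convex_body centroid_body.
Proof.
split.
- by move=> x [].
- exact: closed_centroid_body.
- exact: sph_convex_centroid_body.
- move=> CS; have : centroid_body (- e).
    by rewrite CS; apply: unit_sphere_dotP; rewrite dotNl dotNr opprK.
  by move=> /centroid_body_gt0; rewrite dotNr ee ltNge lerN10.
- by exists e; exact: center_interior.
Qed.

Lemma centroidE u : sph_centroid (K `&` hemisphere u) = normalize (half_moment K u).
Proof. by []. Qed.

Lemma half_moment_cone u : great_subsphere e u -> centroid_cone (half_moment K u).
Proof.
move=> [u1 eu] w ew; have u0 := unit_sphere_neq0 u1.
rewrite (dot_center_half_moment e1 K1 cK)// mulrA mulrAC ler_wpM2r ?(ltW T0)//.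
exact: (dot_half_moment_le e1 K1 cK K_refl u0 eu ew).
Qed.

Lemma half_moment_neq0 u : great_subsphere e u -> half_moment K u != 0.
Proof.
move=> [u1 eu]; have u0 := unit_sphere_neq0 u1.
have := dot_center_half_moment e1 K1 cK K_refl K_ge0 u0 eu.
have [->|//] := eqVneq (half_moment K u) 0.
by rewrite dot0r => /esym/eqP; rewrite mulf_eq0 invr_eq0 pnatr_eq0 orbF gt_eqF.
Qed.

Lemma rel_boundary_centroid_body :
  rel_boundary unit_sphere centroid_body =
  [set sph_centroid (K `&` hemisphere u) | u in great_subsphere e].
Proof.
have clE : closure centroid_body = centroid_body.
  by rewrite -((closure_id _).1 closed_centroid_body).
apply/seteqP; split => [v [[]]|_ [u eu <-]].
  rewrite clE => Cv v1 nint.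
  have [w [w1 ew] wv] : exists2 w, great_subsphere e w & `|dot w v| * T = W w * dot e v.
    apply: contrapT => nw; apply: nint; apply: centroid_body_interior => // w ew.
    rewrite lt_neqAle (Cv.2 _ ew.2) andbT; apply/eqP => wv; apply: nw.
    by exists w.
  (* The constraint is even in [w], whereas [half_moment_support] asks for equality without absolute
     value. *)
  wlog wv0 : w w1 ew wv / 0 <= dot w v.
    move=> H; have [/H|/ltW wv0] := leP 0 (dot w v); first exact.
    apply: (H (- w)).
    + by apply: unit_sphere_dotP; rewrite dotNl dotNr opprK unit_sphere_dot.
    + by rewrite /orthogonal_compl/= dotNr ew oppr0.
    + by rewrite dotNl normrN widthN.
    + by rewrite dotNl oppr_ge0.
  have ev := centroid_body_gt0 Cv.
  (* [c *: v] has the height [T / 2] along [e] common to all half moments. *)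
  pose c := T / 2 / dot e v; have c0 : 0 < c by rewrite !divr_gt0.
  exists w => //; rewrite centroidE.
  have cE t : c * t = t * T / dot e v / 2 by rewrite /c; ring.
  rewrite -(@half_moment_support _ _ e K e1 K1 cK K_refl K_ge0 w (c *: v)).
  - by rewrite normalizeZ// normalize_unit.
  - exact: unit_sphere_neq0.
  - exact: ew.
  - by rewrite dotZr /c divfK// gt_eqF.
  - move=> w' ew'; rewrite dotZr cE ler_pM2r ?invr_gt0// ler_pdivrMr//.
    by rewrite (le_trans _ (Cv.2 _ ew'))// ler_wpM2r ?(ltW T0)// ler_norm.
  - by rewrite dotZr cE -{1}(ger0_norm wv0) wv mulfK// gt_eqF.
have [u1 eu0] := eu; have u0 := unit_sphere_neq0 u1.
have Cc := half_moment_cone eu; have c0 := half_moment_neq0 eu.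
rewrite centroidE; split.
  split; last exact: enorm_normalize.
  by rewrite clE; exact: centroid_cone_normalize.
(* At this centroid the constraint of direction [u] is tight; a push along [u] raises its left side
   and leaves [dot e] unchanged. *)
move=> /(rel_interior_sphere_path u)[t t0 [_]].
set c := normalize (half_moment K u) => Ct.
have Cct : centroid_cone (c + t *: u).
  by rewrite [X in centroid_cone X]scale_normalize; apply: centroid_coneZ; [exact: enorm_ge0|exact: Ct].
have := Cct _ eu0.
rewrite !dotDr !(dotZr t) eu0 mulr0 addr0 (unit_sphere_dot u1) mulr1.
rewrite /c !dot_normalize (dot_center_half_moment e1 K1 cK)//.
rewrite (dot_half_moment_self e1 K1 cK)//.
set a := (enorm _)^-1; have a0 : 0 <= a by rewrite invr_ge0 enorm_ge0.
have Wu : 0 <= W u by exact: width_ge0.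
have aW : 0 <= a * (W u / 2) by rewrite !mulr_ge0.
rewrite ger0_norm ?addr_ge0 ?(ltW t0)// (_ : W u * (a * (T / 2)) = a * (W u / 2) * T); last by ring.
by rewrite ler_pM2r// leNgt ltrDl t0.
Qed.

End centroid_body.

(** * Uniqueness, symmetry and gnomonic image of the centroid body *)

Section centroid_body_uniqueness.
Context {R : realType} {n : nat}.
Variables (e : 'rV[R]_n.+1) (K : set 'rV[R]_n.+1).
Hypothesis n0 : (0 < n)%N.
Hypothesis e1 : unit_sphere e.
Hypotheses (K1 : K `<=` unit_sphere) (cK : closed K).
Hypothesis K_int : rel_interior unit_sphere K !=set0.
Hypothesis K_refl : forall x, K x -> K (sph_reflection e x).
Hypothesis K_ge0 : forall x, K x -> 0 <= dot e x.

(** The body is first forced into the open hemisphere of [e], because [sub_same_boundary] leaves it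
    along segments to the equator. *)
Lemma is_sph_centroid_body_unique GK :
  is_sph_centroid_body e K GK -> GK = centroid_body e K.
Proof.
move=> [bGK bdGK].
have bC := sph_convex_body_centroid_body n0 e1 K1 cK K_int.
have bdC := rel_boundary_centroid_body n0 e1 K1 cK K_int K_refl K_ge0.
have Cgt0 := centroid_body_gt0 n0 e1 K1 cK K_int.
have [d Sd] := exists_unit_orthogonal n0 e1; have [d1 ed] := Sd.
have bd_sub (A : set 'rV[R]_n.+1) : sph_convex_body A -> rel_boundary unit_sphere A `<=` A.
  by move=> [_ cA _ _ _] x [[]]; rewrite -((closure_id A).1 cA).
have eqbd : rel_boundary unit_sphere GK = rel_boundary unit_sphere (centroid_body e K).
  by rewrite bdGK bdC.
have GKgt0 x : GK x -> 0 < dot e x.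
  apply: (body_in_open_hemisphere e1 bGK).
    by rewrite eqbd => y /(bd_sub _ bC)/Cgt0.
  by rewrite bdGK; exists (sph_centroid (K `&` hemisphere d)); exists d.
apply/seteqP; split.
  by apply: (sub_same_boundary bGK bC _ GKgt0 d1 ed); rewrite eqbd; exact: bd_sub.
by apply: (sub_same_boundary bC bGK _ Cgt0 d1 ed); rewrite -eqbd; exact: bd_sub.
Qed.

Lemma sph_centrally_symmetric_centroid_body :
  sph_centrally_symmetric e (centroid_body e K).
Proof.
have refl x : centroid_body e K x -> centroid_body e K (sph_reflection e x).
  move=> [x1 Cx]; split.
    rewrite sph_reflectionE /unit_sphere/= enorm_mulmx//.
    exact: reflection_mx_orthogonal.
  move=> w ew; rewrite !dot_sph_reflection (dotC w e) ew mulr0 addr0 normrN.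
  by rewrite unit_sphere_dot// mulr1 (dotC x e) (_ : - _ + _ = dot e x) ?Cx//; ring.
split; last first.
  move=> x Cx; split; first by case: Cx.
  exact/ltW/(centroid_body_gt0 n0 e1 K1 cK K_int Cx).
apply/seteqP; split => [_ [x Cx <-]|x Cx]; first exact: refl.
by exists (sph_reflection e x); [exact: refl|exact: sph_reflectionK].
Qed.

Lemma sph_proper_centroid_body : sph_proper (centroid_body e K).
Proof.
exists e => // x Cx; rewrite open_hemisphereE//; split; first by case: Cx.
exact: (centroid_body_gt0 n0 e1 K1 cK K_int Cx).
Qed.

Local Notation W := (width K).
Local Notation T := (width K e).
Let T0 : 0 < T. Proof. exact/(width_gt0 K1 cK K_int)/unit_sphere_neq0. Qed.

Let L := gnomonic e @` centroid_body e K.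

(** On the tangent hyperplane [dot e (e + x) = 1], so the cone constraints become slabs in [x]. *)
Let LE : L = [set x | dot e x = 0 /\
  forall w, dot e w = 0 -> `|dot w x| * T <= W w].
Proof.
rewrite /L gnomonic_imageE//; last 2 first.
- by move=> x [].
- exact: (centroid_body_gt0 n0 e1 K1 cK K_int).
have ee := unit_sphere_dot e1.
apply/seteqP; split => x /= [ex Cx]; split => //.
  have ex1 : dot e (e + x) = 1 by rewrite dotDr ee ex addr0.
  have ex0 : e + x != 0.
    by apply: contraTneq isT => ex0; have := dot0r e; rewrite -ex0 ex1 => /eqP; rewrite oner_eq0.
  move=> w ew; have [_ /(centroid_coneZ (enorm_ge0 (e + x)))] := Cx.
  rewrite -scale_normalize => /(_ w ew).
  by rewrite ex1 mulr1 dotDr (dotC w e) ew add0r.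
have ex1 : dot e (e + x) = 1 by rewrite dotDr ee ex addr0.
apply: centroid_cone_normalize.
  by apply/eqP => ex0; have := dot0r e; rewrite -ex0 ex1 => /eqP; rewrite oner_eq0.
by move=> w ew; rewrite ex1 mulr1 dotDr (dotC w e) ew add0r; exact: Cx.
Qed.

Let gnomonic_support u : dot e u = 0 -> support_function L u = W u / T.
Proof.
move=> eu.
have ub : ubound [set dot u x | x in L] (W u / T).
  move=> _ [x + <-]; rewrite LE => -[ex Lx]; rewrite ler_pdivlMr//.
  by rewrite (le_trans _ (Lx u eu))// ler_wpM2r ?(ltW T0)// ler_norm.
have max : [set dot u x | x in L] (W u / T).
  have [->|u0] := eqVneq u 0.
    have W0 : W 0 = 0 by rewrite -(scale0r e) widthZ// normr0 mul0r.
    rewrite W0 mul0r; exists 0; last by rewrite dot0r.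
    rewrite LE; split=> [|w ew]; first by rewrite dot0r.
    by rewrite dot0r normr0 mul0r width_ge0.
  have c1 := dot_center_half_moment e1 K1 cK K_refl K_ge0 u0 eu.
  have c2 := dot_half_moment_self e1 K1 cK K_refl u0 eu.
  (* The gnomonic image of the centroid of direction [u]: its half moment has height [T / 2] along
     [e]. *)
  exists ((2 / T) *: half_moment K u - e).
    rewrite LE; split.
      rewrite dotDr dotNr dotZr c1 unit_sphere_dot// mulrA divfK ?gt_eqF//.
      by rewrite divff ?subrr// pnatr_eq0.
    move=> w ew; rewrite dotDr dotNr (dotC w e) ew subr0 dotZr normrM.
    rewrite ger0_norm ?divr_ge0 ?(ltW T0)// mulrAC divfK ?gt_eqF// mulrC -ler_pdivlMr//.
    exact: (dot_half_moment_le e1 K1 cK K_refl u0 eu ew).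
  rewrite dotDr dotNr (dotC u e) eu subr0 dotZr c2.
  by field; exact: lt0r_neq0.
apply/eqP; rewrite eq_le; apply/andP; split.
  by apply: ge_sup ub; exists (W u / T).
by apply: ub_le_sup max; exists (W u / T).
Qed.

Lemma is_tau_centroid_body_gnomonic B : orthonormal_frame e B ->
  is_tau_centroid_body e B (gnomonic e @` (K `&` open_hemisphere e)) L.
Proof.
move=> eB; have ee := unit_sphere_dot e1.
have Cgt0 := centroid_body_gt0 n0 e1 K1 cK K_int.
have C1 : centroid_body e K `<=` unit_sphere by move=> x [].
split.
- by rewrite LE => x [].
- apply: continuous_compact; last first.
    by apply: compact_sub_sphere => //; exact: closed_centroid_body.
  apply: continuous_in_subspaceT => x /set_mem Cx.
  have FF : Filter (nbhs x) := nbhs_filter x.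
  apply: cvgB; last exact: cvg_cst.
  apply: cvgZ; last exact: cvg_id.
  apply: cvgV; first by rewrite gt_eqF// Cgt0.
  exact: (@continuous_dot _ _ e x).
- apply/convex_rowP => x y t; rewrite LE => -[ex Lx] [ey Ly] /andP[t0 t1].
  have t1' : 0 <= 1 - t by rewrite subr_ge0.
  split; first by rewrite dotDr !dotZr ex ey !mulr0 addr0.
  move=> w ew; rewrite dotDr !dotZr.
  have h1 := ler_wpM2l t0 (Lx w ew); have h2 := ler_wpM2l t1' (Ly w ew).
  have -> : W w = t * W w + (1 - t) * W w by ring.
  rewrite (le_trans _ (lerD h1 h2))// !mulrA -mulrDl ler_wpM2r ?(ltW T0)//.
  by rewrite (le_trans (ler_normD _ _))// !normrM (ger0_norm t0) (ger0_norm t1').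
- exists 0; split; first by rewrite /orthogonal_compl/= dot0r.
  have /(rel_interior_sphereP _ e1) eC := center_interior e1 K1 cK K_int.
  have ce : (e + x) @[x --> (0 : 'rV[R]_n.+1)] --> e.
    have FF : Filter (nbhs (0 : 'rV[R]_n.+1)) := nbhs_filter _.
    by rewrite -[X in _ --> X]addr0; apply: cvgD; [exact: cvg_cst|exact: cvg_id].
  have : nbhs (0 : 'rV[R]_n.+1) [set x | centroid_body e K (normalize (e + x))].
    exact: (ce _ eC).
  rewrite /within/=; apply: filterS => x /= Cx ex.
  by rewrite /L gnomonic_imageE.
move=> u eu; rewrite gnomonic_support//.
pose A := K `&` open_hemisphere e.
(* As [dot e] is nonnegative on [K], passing to the open hemisphere removes only points of a null
   hyperplane, so integrals over [A] are those over [K]. *)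
have AE : A = K `\` orthogonal_compl e.
  rewrite /A open_hemisphereE//; apply/seteqP; split => x [Kx] /=.
    by move=> [_ ex]; split => //; rewrite /orthogonal_compl/= => ex0; rewrite ex0 ltxx in ex.
  move=> ex; split => //; split; first exact: K1.
  by rewrite lt_neqAle K_ge0// andbT eq_sym; apply/eqP.
have mK := measurable_closed_row cK.
have mA : measurable A.
  by rewrite AE; apply: measurableD => //; exact: measurable_orthogonal_compl.
have A1 : A `<=` unit_sphere by move=> x [/K1].
have Ae x : A x -> 0 < dot e x.
  by move=> [_]; rewrite open_hemisphereE// => -[].
have intA w : (\int[@spherical_measure R n.+1]_(x in A) `|dot w x|%:E = (W w)%:E)%E.
  rewrite AE -ge0_negligible_integral//; first last.
  - exact/spherical_measure_hyperplane0/unit_sphere_neq0.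
  - by apply: (measurable_funS measurableT) => //; apply/measurable_EFinP; exact: measurable_norm_dot.
  - exact: measurable_orthogonal_compl.
  by rewrite fineK//; apply: integrable_fin_num => //; exact: integrable_norm_dot.
have normZ w t (x : 'rV[R]_n.+1) : 0 < t -> `|dot w (t *: x)| = t * `|dot w x|.
  by move=> t0; rewrite dotZr normrM gtr0_norm.
have gI w := integral_gnomonic e1 eB mA A1 Ae (measurable_norm_dot w)
  (fun x => normr_ge0 _) (normZ w).
have intM : (\int[tau_hat B]_(x in gnomonic e @` A) (`|dot u x|)%:E = (W u)%:E)%E.
  rewrite -intA -gI; apply: eq_integral => x _.
  by rewrite dotDr (dotC u e) eu add0r.
(* The case [w = e] of the change of variables: [|dot e (e + x)|] is constantly 1 on the hyperplane,
   so it yields the total mass. *)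
have tauM : (tau_hat B (gnomonic e @` A) = T%:E)%E.
  have mM := measurable_gnomonic_image e1 A1 Ae mA.
  rewrite -intA -gI -[LHS]mul1e -integral_cst//; apply: eq_integral => x.
  rewrite gnomonic_imageE// inE => -[ex _].
  by rewrite dotDr ee ex addr0 normr1.
by rewrite -/A tauM /Rintegral intM/= mulrC.
Qed.

End centroid_body_uniqueness.

Theorem corollary3p5 (R : realType) (n : nat) (e : 'rV[R]_n.+1)
    (K : set 'rV[R]_n.+1) :
  (2 <= n)%N ->
  unit_sphere e ->
  sph_convex_body K ->
  sph_centrally_symmetric e K ->
  (exists! GK : set 'rV[R]_n.+1, is_sph_centroid_body e K GK) /\
  (forall GK : set 'rV[R]_n.+1, is_sph_centroid_body e K GK ->
    [/\ sph_convex_body GK,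
        sph_centrally_symmetric e GK,
        sph_proper GK &
        forall B : 'M[R]_(n, n.+1), orthonormal_frame e B ->
          is_tau_centroid_body e B
            (gnomonic e @` (K `&` open_hemisphere e)) (gnomonic e @` GK)]).
Proof.
move=> n2 e1 [K1 cK _ _ K_int] [K_sym K_hemi].
have n0 : (0 < n)%N by exact: ltnW.
have K_refl x : K x -> K (sph_reflection e x).
  by move=> Kx; rewrite -K_sym; exists x.
have K_ge0 x : K x -> 0 <= dot e x by move=> /K_hemi[].
have unique := is_sph_centroid_body_unique n0 e1 K1 cK K_int K_refl K_ge0.
have bC := sph_convex_body_centroid_body n0 e1 K1 cK K_int.
split.
  exists (centroid_body e K); split; last by move=> GK /unique.
  split => //; exact: rel_boundary_centroid_body.
move=> _ /unique ->; split => //.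
- exact: sph_centrally_symmetric_centroid_body.
- exact: sph_proper_centroid_body.
- by move=> B eB; exact: is_tau_centroid_body_gnomonic.
Qed.
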